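(* Let $n\ge1$ be an integer, $\alpha>n$ a real number, and $\theta=\kappa=\frac{n+\alpha}{n-\alpha}$. If $(u,v)$ is a pair of positive finite smooth functions on $\mathbb{R}^n$ solving $$u(y)=\int_{\mathbb{R}^n}|x-y|^{\alpha-n}v^{\kappa}(x)\,dx\quad(y\in\mathbb{R}^n),\qquad v(x)=\int_{\mathbb{R}^n}|x-y|^{\alpha-n}u^{\theta}(y)\,dy\quad(x\in\mathbb{R}^n),$$ then $u,v$ must be of the following form on $\mathbb{R}^n$: $$u(\xi)=c_1\left(\frac{1}{|\xi-\xi_0|^2+d^2}\right)^{\frac{n-\alpha}{2}},\qquad v(\xi)=c_2\left(\frac{1}{|\xi-\xi_0|^2+d^2}\right)^{\frac{n-\alpha}{2}},$$ for some $c_1,c_2>0$, $d>0$ and $\xi_0\in\mathbb{R}^n$ (the same $d$ and $\xi_0$ for both functions). *)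

(* Defs.v *)
From HB Require Import structures.
From mathcomp Require Import all_boot all_order all_algebra.
From mathcomp Require Import all_classical all_reals all_analysis.

Set Implicit Arguments.
Unset Strict Implicit.
Unset Printing Implicit Defensive.

Import Order.TTheory GRing.Theory Num.Theory.
Import numFieldNormedType.Exports.

Local Open Scope classical_set_scope.
Local Open Scope ring_scope.

(* The norm [`|x|] that the library puts on ['rV[R]_n] is the sup norm. *)
Definition enorm (R : rcfType) (n : nat) (x : 'rV[R]_n) : R :=
  Num.sqrt (\sum_(i < n) x ord0 i ^+ 2).

Definition partial (R : realType) (n : nat) (i : 'I_n) (f : 'rV[R]_n -> R) :
    'rV[R]_n -> R :=
  fun x => 'D_(delta_mx ord0 i) f x.

Definition iter_partial (R : realType) (n : nat) (s : seq 'I_n)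
    (f : 'rV[R]_n -> R) : 'rV[R]_n -> R :=
  foldr (@partial R n) f s.

(* C^oo: the partial derivatives of all orders exist and are continuous.
   The existence clause is needed because ['D_v f x] is total. *)
Definition smooth (R : realType) (n : nat) (f : 'rV[R]_n -> R) : Prop :=
  forall s : seq 'I_n,
    continuous (iter_partial s f) /\
    forall (i : 'I_n) (x : 'rV[R]_n),
      derivable (iter_partial s f) x (delta_mx ord0 i).

(* The Borel sigma-algebra of R^n, as the product sigma-algebra: it is
   generated by the n coordinate maps, as in the library's instance for
   [n.-tuple T]. *)
Definition rV_display : measure_display -> measure_display.
Proof. exact. Qed.

Section measurable_rV.
Context {d : measure_display} {T : sigmaRingType d} (n : nat).

Let coord : 'I_n -> 'rV[T]_n -> T := fun i x => x ord0 i.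

Let rV_set0 : g_sigma_preimage coord set0.
Proof. exact: sigma_algebra0. Qed.

Let rV_setC A : g_sigma_preimage coord A -> g_sigma_preimage coord (~` A).
Proof. exact: sigma_algebraC. Qed.

Let rV_bigcup (F : (set 'rV[T]_n)^nat) :
  (forall i, g_sigma_preimage coord (F i)) ->
  g_sigma_preimage coord (\bigcup_i (F i)).
Proof. exact: sigma_algebra_bigcup. Qed.

HB.instance Definition _ := @isMeasurable.Build (rV_display d)
  'rV[T]_n (g_sigma_preimage coord) rV_set0 rV_setC rV_bigcup.

End measurable_rV.

Lemma measurable_coord (d : measure_display) (T : sigmaRingType d) (n : nat)
    (i : 'I_n) :
  measurable_fun [set: 'rV[T]_n] (fun x : 'rV[T]_n => x ord0 i).
Proof.
move=> _ Y mY; rewrite setTI; apply: sub_sigma_algebra => /=.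
rewrite -bigcup_seq/=; exists i => /=; first by rewrite mem_index_enum.
by exists Y => //; rewrite setTI.
Qed.

Lemma measurable_fun_rV (d1 d2 : measure_display) (T1 : measurableType d1)
    (T2 : measurableType d2) (n : nat) (f : T1 -> 'rV[T2]_n) :
  (forall i, measurable_fun [set: T1] (fun x => f x ord0 i)) ->
  measurable_fun [set: T1] f.
Proof.
move=> mf _ Y mY; rewrite setTI.
suff : [set A | measurable (f @^-1` A)] Y by [].
apply: mY; split.
  split => /=.
  - by rewrite preimage_set0.
  - by move=> A mA; rewrite setTD preimage_setC; exact: measurableC.
  - by move=> F mF; rewrite preimage_bigcup; exact: bigcup_measurable.
rewrite -bigcup_seq => A [i _ [B mB <-]] /=.
have := mf i measurableT B mB.
by rewrite !setTI.
Qed.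

Section lebesgue_measure_rV.
Context (R : realType).
Local Notation RT := (measurableTypeR R).

Definition cons_rV (n : nat) (p : RT * 'rV[RT]_n) : 'rV[RT]_n.+1 :=
  \row_i oapp (fun j => p.2 ord0 j) p.1 (unlift ord0 i).

Definition uncons_rV (n : nat) (x : 'rV[RT]_n.+1) : RT * 'rV[RT]_n :=
  (x ord0 ord0, \row_i x ord0 (lift ord0 i)).

Lemma cons_rVK n : cancel (@cons_rV n) (@uncons_rV n).
Proof.
move=> [a v]; rewrite /uncons_rV /cons_rV !mxE unlift_none /=; congr pair.
by apply/rowP => i; rewrite !mxE liftK.
Qed.

Lemma measurable_cons_rV n : measurable_fun setT (@cons_rV n).
Proof.
apply: measurable_fun_rV => i; under eq_fun do rewrite mxE.
case: (unliftP ord0 i) => [j _|_] /=.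
- exact: (measurableT_comp (@measurable_coord _ RT n j)
    (@measurable_snd _ _ RT 'rV[RT]_n)).
- exact: measurable_fst.
Qed.

Lemma measurable_uncons_rV n : measurable_fun setT (@uncons_rV n).
Proof.
apply: measurable_fun_pair; first exact: measurable_coord.
apply: measurable_fun_rV => i; under eq_fun do rewrite mxE.
exact: measurable_coord.
Qed.

HB.instance Definition _ n :=
  isMeasurableFun.Build _ _ _ _ (@cons_rV n) (@measurable_cons_rV n).

Section step.
Context (n : nat) (mu : {sigma_finite_measure set 'rV[RT]_n -> \bar R}).

Definition lebesgue_rV_step : set 'rV[RT]_n.+1 -> \bar R :=
  pushforward (lebesgue_measure \x mu)%E (@cons_rV n).

Let lebesgue_rV_step0 : lebesgue_rV_step set0 = 0%E.
Proof. exact: measure0. Qed.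

Let lebesgue_rV_step_ge0 A : (0 <= lebesgue_rV_step A)%E.
Proof. exact: measure_ge0. Qed.

Let lebesgue_rV_step_sigma_additive : semi_sigma_additive lebesgue_rV_step.
Proof. exact: measure_semi_sigma_additive. Qed.

HB.instance Definition _ := isMeasure.Build _ _ _ lebesgue_rV_step
  lebesgue_rV_step0 lebesgue_rV_step_ge0 lebesgue_rV_step_sigma_additive.

Let lebesgue_rV_step_sigma_finite : sigma_finite setT lebesgue_rV_step.
Proof.
have /sigma_finiteP[F [FT ndF mF]] := sigma_finiteT (@lebesgue_measure R).
have /sigma_finiteP[G [GT ndG mG]] := sigma_finiteT mu.
exists (fun i => @uncons_rV n @^-1` (F i `*` G i)).
  rewrite -preimage_bigcup; apply/esym; rewrite -subTset => x _ /=.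
  have [i _ Fi] : (\bigcup_i F i) (uncons_rV x).1 by rewrite -FT.
  have [j _ Gj] : (\bigcup_i G i) (uncons_rV x).2 by rewrite -GT.
  exists (maxn i j) => //; split.
    by move: Fi; apply/subsetPset/ndF; exact: leq_maxl.
  by move: Gj; apply/subsetPset/ndG; exact: leq_maxr.
move=> i; have [mFi Fi] := mF i; have [mGi Gi] := mG i; split.
  rewrite -[X in measurable X]setTI; apply: measurable_uncons_rV => //.
  exact: measurableX.
rewrite /lebesgue_rV_step /pushforward -comp_preimage.
rewrite (_ : _ \o _ = id); last by apply/funext => x /=; rewrite cons_rVK.
by rewrite preimage_id product_measure1E// lte_mul_pinfty// ge0_fin_numE.
Qed.

HB.instance Definition _ := @Measure_isSigmaFinite.Build _ _ _
  lebesgue_rV_step lebesgue_rV_step_sigma_finite.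

End step.

(* Lebesgue measure on R^n: the n-fold product of the Lebesgue measure on R
   (on R^0 it is the unit mass). *)
Fixpoint lebesgue_rV (n : nat) :
    {sigma_finite_measure set 'rV[RT]_n -> \bar R} :=
  match n return {sigma_finite_measure set 'rV[RT]_n -> \bar R} with
  | 0 => @dirac _ 'rV[RT]_0 (0 : 'rV[R]_0) R
  | n'.+1 => lebesgue_rV_step (lebesgue_rV n')
  end.

Lemma lebesgue_rV_box (n : nat) (A : 'I_n -> set RT) :
  (forall i, measurable (A i)) ->
  (lebesgue_rV n [set x : 'rV[RT]_n | forall i, A i (x ord0 i)] =
   \prod_(i < n) lebesgue_measure (A i))%E.
Proof.
elim: n A => [|n IHn] A mA.
  by rewrite big_ord0 /= diracE mem_set// => -[].
have mB : measurable
    [set x : 'rV[RT]_n | forall i, A (lift ord0 i) (x ord0 i)].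
  rewrite (_ : [set _ | _] = \bigcap_(i in [set: 'I_n])
      ((fun x : 'rV[RT]_n => x ord0 i) @^-1` A (lift ord0 i))); last first.
    by apply/seteqP; split => [x Ax i _|x Ax i]; [exact: Ax|exact: (Ax i)].
  apply: fin_bigcap_measurable => // i _; rewrite -[X in measurable X]setTI.
  exact: measurable_coord.
rewrite big_ord_recl -IHn//.
rewrite -(product_measure1E (@lebesgue_measure R) (lebesgue_rV n))//.
rewrite /= /lebesgue_rV_step /pushforward; congr (product_measure1 _ _ _).
apply/seteqP; split => [[a v]/= Aav|[a v]/= [Aa Av] i].
  split=> [|i]; first by have := Aav ord0; rewrite mxE unlift_none.
  by have := Aav (lift ord0 i); rewrite mxE liftK.
by rewrite mxE; case: unliftP => [j ->|->].
Qed.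

End lebesgue_measure_rV.

(* Main.v *)
(* Put p = alpha - n > 0 and q = (n + alpha) / p, so that theta = kappa = - q and
   p q = p + 2 n. The system is covariant under translations, dilations and the
   Kelvin transform u* y = |y|^p u (y / |y|^2). With A = |y - z|^p and
   K = |y|^p |y / |y|^2 - z|^p, folding R^n onto the unit ball B by inversion gives
     u y - u* y = int_B (K - A) (y, z) (v* z ^ (- q) - v z ^ (- q)) dz,
   where K > A on B, and the same with u and v exchanged. Moving spheres: around
   any center, u and v rescaled by a small radius l dominate their Kelvin
   transforms on B. This fails for large l, and can be continued beyond any l at
   which the domination is not an equality: a single strict inequality makes both
   strict everywhere on B, and near the boundary, where compactness is of no help,
   the kernel identity on a set of small measure rules out violations. Hence each
   center x has a radius l(x) at which u and v equal their Kelvin transforms.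
   At y = 0 this says u x = l(x)^p a and v x = l(x)^p b, with a and b the
   integrals of v^(- q) and u^(- q), so w = l^2 satisfies
     w (x + l(x) y) = |y|^2 w (x + l(x) y / |y|^2).
   Differentiating this identity along lines shows that w is |x - xi|^2 + d^2. *)

From HB Require Import structures.
Require Import Defs.
From mathcomp Require Import all_boot all_order all_algebra.
From mathcomp Require Import all_classical all_reals all_analysis.
From mathcomp Require Import measurable_realfun.
From mathcomp Require Import ring lra.

Set Implicit Arguments.
Unset Strict Implicit.
Unset Printing Implicit Defensive.

Import Order.TTheory GRing.Theory Num.Theory.
Import numFieldNormedType.Exports.

Local Open Scope classical_set_scope.
Local Open Scope ring_scope.

(** * Changes of variables in Lebesgue integrals *)

(** Everything rests on one sign: [v] enters the equation for [u] only through [v^(- q)], which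
    decreases in [v]. So [v* <= v] on B forces [u* <= u] there; each function is controlled through
    the other, and every comparison treats the pair at once. The same sign explains the role of
    small measure: if the ratios [u* / u] and [v* / v] are at most [M > 1], violations confined to a
    set E cost at most [1 - M^(- q) <= q (M - 1)] times a multiple of the measure of E, too little
    to sustain [M]. For small [l] this applies with E = B, since the rescaled functions are large;
    to continue past a given [l], with E a thin shell along the sphere. Large [l] are excluded by
    the value at the center alone. The other obstacle is the point at infinity, which the Kelvin
    transform brings to 0, no growth of [u] being assumed. Finiteness of [u] at two points makes
    [(1 + |z|)^p v^(- q)] integrable, and from this [u*], written as an integral of [v], is finite
    and continuous at 0. *)

Lemma ge0_integral_transfer d1 d2 (X : measurableType d1)
    (Y : measurableType d2) (R : realType) (phi : X -> Y)
    (mu : {measure set X -> \bar R}) (nu : {measure set Y -> \bar R})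
    (f : Y -> \bar R) :
  measurable_fun setT phi ->
  (forall A, measurable A -> nu A = mu (phi @^-1` A)) ->
  measurable_fun setT f -> (forall y, (0 <= f y)%E) ->
  (\int[mu]_x f (phi x) = \int[nu]_y f y)%E.
Proof.
move=> mphi nuE mf f0.
pose g : {mfun X >-> Y} := HB.pack phi (isMeasurableFun.Build _ _ _ _ _ mphi).
rewrite -(@ge0_integral_pushforward _ _ _ _ R g mphi mu setT f) //.
by apply: eq_measure_integral => A mA _ /=; rewrite /pushforward nuE.
Qed.

Section lebesgue_1d.
Context {R : realType}.
Local Notation mu := (@lebesgue_measure R).
Local Open Scope ereal_scope.

(** Lebesgue measure is determined by its values on half-open intervals, so it is enough to compute
    the image measure on those. *)
Lemma ge0_integral_shift (f : R -> \bar R) (a : R) :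
  measurable_fun [set: R] f -> (forall r, 0 <= f r) ->
  \int[mu]_t f (t + a)%R = \int[mu]_t f t.
Proof.
move=> mf f0.
have mg : @measurable_fun _ _ (measurableTypeR R) (measurableTypeR R) setT
    (fun t : R => t + a)%R
  by exact: measurable_funD.
apply: (@ge0_integral_transfer _ _ (measurableTypeR R) (measurableTypeR R) R
  (fun t => t + a)%R mu mu) => //.
pose g : {mfun measurableTypeR R >-> measurableTypeR R} :=
  HB.pack (fun t : R => t + a)%R (isMeasurableFun.Build _ _ _ _ _ mg).
apply: (@lebesgue_measure_unique R (pushforward mu g)) => // _ [[x y] _ <-].
transitivity (mu `](x - a)%R, (y - a)%R]%classic); last first.
  congr (mu _).
  by apply/seteqP; split => t /=; rewrite !in_itv/= ltrBlDr lerBrDr.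
rewrite !lebesgue_measure_itv/= !lte_fin ltrD2r.
by case: ifP => // _; congr EFin; lra.
Qed.

Lemma ge0_integral_opp (f : R -> \bar R) :
  measurable_fun [set: R] f -> (forall r, 0 <= f r) ->
  \int[mu]_t f (- t)%R = \int[mu]_t f t.
Proof.
move=> mf f0.
apply: (@ge0_integral_transfer _ _ (measurableTypeR R) (measurableTypeR R) R
  -%R mu mu) => // A mA.
by rewrite -[LHS]lebesgue_measureN.
Qed.

Lemma ge0_integral_dilation (f : R -> \bar R) (r : R) : (0 < r)%R ->
  measurable_fun [set: R] f -> (forall t, 0 <= f t) ->
  r%:E * \int[mu]_t f (r * t)%R = \int[mu]_t f t.
Proof.
move=> r0 mf f0.
have mg : @measurable_fun _ _ (measurableTypeR R) (measurableTypeR R) setT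
    ( *%R r) by exact: measurable_funM.
pose g : {mfun measurableTypeR R >-> measurableTypeR R} :=
  HB.pack ( *%R r) (isMeasurableFun.Build _ _ _ _ _ mg).
pose nr : {nonneg R} := NngNum (ltW r0).
have muE A : measurable A -> mu A = mscale nr (pushforward mu g) A.
  move=> mA; apply: lebesgue_measure_unique mA => //= _ [[x y] _ <-].
  transitivity (r%:E * mu `](x / r)%R, (y / r)%R]%classic); last first.
    apply: (congr1 (fun A => r%:E * mu A)).
    apply/seteqP; split => t /=.
      by rewrite !in_itv/= ltr_pdivrMr// ler_pdivlMr// mulrC.
    by rewrite !in_itv/= ltr_pdivrMr// ler_pdivlMr// mulrC.
  rewrite !lebesgue_measure_itv/= !lte_fin ltr_pM2r ?invr_gt0//.
  case: ifP => // _; rewrite ?mule0// -EFinM; congr EFin; field.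
  by rewrite gt_eqF.
rewrite [RHS](eq_measure_integral (mscale nr (pushforward mu g))); last first.
  by move=> A mA _; exact: muE.
rewrite ge0_integral_mscale//; apply: (congr1 (mule r%:E)).
exact/esym/ge0_integral_pushforward.
Qed.

End lebesgue_1d.

Section lebesgue_rV.
Context {R : realType}.
Local Open Scope ereal_scope.

Lemma ge0_integral_rV_recl n (f : 'rV[R]_n.+1 -> \bar R) :
  measurable_fun setT f -> (forall x, 0 <= f x) ->
  \int[lebesgue_rV R n.+1]_x f x =
  \int[lebesgue_measure]_a \int[lebesgue_rV R n]_v f (cons_rV (a, v)).
Proof.
move=> mf f0.
rewrite -(@fubini_tonelli1 _ _ _ _ R lebesgue_measure (lebesgue_rV R n)
  (fun p => f (cons_rV p))) //.
- by apply/esym/ge0_integral_transfer => //; exact: measurable_cons_rV.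
- exact: (measurableT_comp mf (@measurable_cons_rV R n)).
Qed.

Lemma measurable_fun_cons_rVr n (f : 'rV[R]_n.+1 -> \bar R) a :
  measurable_fun setT f ->
  measurable_fun setT (fun v : 'rV[R]_n => f (cons_rV (a, v))).
Proof.
move=> mf; apply: (measurableT_comp mf).
exact: (measurableT_comp (@measurable_cons_rV R n)).
Qed.

Lemma measurable_fun_cons_rV_int n (f : 'rV[R]_n.+1 -> \bar R) :
  measurable_fun setT f -> (forall x, 0 <= f x) ->
  measurable_fun [set: R]
    (fun a => \int[lebesgue_rV R n]_v f (cons_rV (a, v))).
Proof.
move=> mf f0.
apply: (@measurable_fun_fubini_tonelli_F _ _ _ _ R (lebesgue_rV R n)
  (fun p => f (cons_rV p))) => //.
exact: (measurableT_comp mf (@measurable_cons_rV R n)).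
Qed.

Lemma measurable_rV_shift n (b : 'rV[R]_n) :
  measurable_fun setT (fun x : 'rV[R]_n => x + b)%R.
Proof.
apply: measurable_fun_rV => i; under eq_fun do rewrite mxE.
apply: measurable_funD => //; exact: measurable_coord.
Qed.

Lemma measurable_rV_dilation n (r : R) :
  measurable_fun setT (fun x : 'rV[R]_n => r *: x)%R.
Proof.
apply: measurable_fun_rV => i; under eq_fun do rewrite mxE.
apply: measurable_funM => //; exact: measurable_coord.
Qed.

Lemma ge0_integral_rV_shift n (f : 'rV[R]_n -> \bar R) (b : 'rV[R]_n) :
  measurable_fun setT f -> (forall x, 0 <= f x) ->
  \int[lebesgue_rV R n]_x f (x + b)%R = \int[lebesgue_rV R n]_x f x.
Proof.
elim: n f b => [|n IHn] f b mf f0.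
  by apply: eq_integral => x _; congr f; apply/rowP => -[].
rewrite !ge0_integral_rV_recl//; last first.
  exact: (measurableT_comp mf (measurable_rV_shift b)).
pose b' := (\row_i b ord0 (lift ord0 i))%R.
have consD a (v : 'rV[R]_n) :
    (cons_rV (a, v) + b)%R = cons_rV ((a + b ord0 ord0)%R, (v + b')%R).
  by apply/rowP => i; rewrite !mxE; case: unliftP => [j ->|->] /=; rewrite ?mxE.
under eq_integral do under eq_integral do rewrite consD.
rewrite -[RHS](ge0_integral_shift (b ord0 ord0)); last 2 first.
- exact: measurable_fun_cons_rV_int.
- by move=> a; exact: integral_ge0.
apply: eq_integral => a _.
rewrite (IHn (fun v => f (cons_rV ((a + b ord0 ord0)%R, v)))) //.
exact: measurable_fun_cons_rVr.
Qed.

Lemma ge0_integral_rV_dilation n (f : 'rV[R]_n -> \bar R) (r : R) :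
  (0 < r)%R -> measurable_fun setT f -> (forall x, 0 <= f x) ->
  (r ^+ n)%:E * \int[lebesgue_rV R n]_x f (r *: x)%R =
  \int[lebesgue_rV R n]_x f x.
Proof.
move=> r0; elim: n f => [|n IHn] f mf f0.
  rewrite expr0 mul1e.
  by apply: eq_integral => x _; congr f; apply/rowP => -[].
rewrite !ge0_integral_rV_recl//; last first.
  exact: (measurableT_comp mf (@measurable_rV_dilation _ r)).
have consZ a (v : 'rV[R]_n) :
    (r *: cons_rV (a, v))%R = cons_rV ((r * a)%R, (r *: v)%R).
  by apply/rowP => i; rewrite !mxE; case: unliftP => [j _|_] /=; rewrite ?mxE.
rewrite -[RHS](ge0_integral_dilation r0); last 2 first.
- exact: measurable_fun_cons_rV_int.
- by move=> a; exact: integral_ge0.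
rewrite exprS EFinM -muleA -ge0_integralZl//; last 3 first.
- apply: (measurable_fun_cons_rV_int (f := fun x => f (r *: x)%R)) => //.
  exact: (measurableT_comp mf (@measurable_rV_dilation _ r)).
- by move=> a _; exact: integral_ge0.
- by rewrite lee_fin exprn_ge0// ltW.
congr (_ * _); apply: eq_integral => a _.
under eq_integral do rewrite consZ.
rewrite (IHn (fun v => f (cons_rV ((r * a)%R, v)))) //.
exact: measurable_fun_cons_rVr.
Qed.

End lebesgue_rV.

(** * The Euclidean structure of R^n *)

(** The sigma-algebra is generated by the coordinates, so [O] is exhibited as the countable union of
    the boxes with rational center and radius [1 / k.+1] that it contains. *)
Lemma open_measurable_rV (R : realType) n (O : set 'rV[R]_n) :
  open O -> measurable O.
Proof.
move=> oO.
pose box (p : 'rV[rat]_n * nat) : set 'rV[R]_n :=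
  [set x | forall i, `|x ord0 i - ratr (p.1 ord0 i)| < p.2.+1%:R^-1].
have mbox p : measurable (box p).
  rewrite (_ : box p = \bigcap_(i in [set: 'I_n]) ((fun x : 'rV[R]_n =>
      x ord0 i) @^-1` [set t : R | `|t - ratr (p.1 ord0 i)| < p.2.+1%:R^-1])).
    apply: fin_bigcap_measurable => // i _; rewrite -[X in measurable X]setTI.
    apply: (@measurable_coord _ (measurableTypeR R) n i) => //.
    rewrite (_ : [set _ | _] = `](ratr (p.1 ord0 i) - p.2.+1%:R^-1),
        (ratr (p.1 ord0 i) + p.2.+1%:R^-1)[%classic) //.
    by apply/seteqP; split => t /=; rewrite in_itv/= ltr_distl.
  by apply/seteqP; split => [x bx i _|x bx i]; [exact: bx|exact: (bx i)].
rewrite (_ : O = \bigcup_p (if `[< box p `<=` O >] then box p else set0)).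
  apply: countable_bigcupT_measurable => // p.
  by case: ifP => // _; exact: measurable0.
apply/seteqP; split => [x Ox|x [p _]]; last by case: asboolP => // + ; exact.
have /nbhs_ballP[e /= e0 xeO] : nbhs x O by exact: open_nbhs_nbhs.
(* A box of radius less than [e / 2] that contains [x] lies in the ball of radius [e] about [x]. *)
have e20 : 0 < e / 2 by rewrite divr_gt0.
have [k _ /(_ _ (leqnn k)) ke] := near_infty_natSinv_lt (PosNum e20).
have /= k0 : 0 < k.+1%:R^-1 :> R by rewrite invr_gt0.
have qP i : {q : rat | `|x ord0 i - ratr q| < k.+1%:R^-1}.
  have xk : x ord0 i - k.+1%:R^-1 < x ord0 i by rewrite ltrBlDr ltrDl.
  apply: cid; have [q] := rat_in_itvoo xk; rewrite in_itv/= => /andP[q1 q2].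
  by exists q; rewrite ger0_norm ?subr_ge0 ?ltW// ltrBlDr addrC -ltrBlDr.
exists (\row_i sval (qP i), k) => //.
case: asboolP => [_ i /=|]; first by rewrite mxE; exact: (svalP (qP i)).
case=> y by_; apply: xeO; split => // i j; rewrite ord1.
have := by_ j; rewrite /= mxE => yq.
rewrite /ball/= (le_lt_trans (ler_distD (ratr (sval (qP j))) _ _))//.
rewrite [e]splitr ltrD//; apply: lt_trans ke; first exact: (svalP (qP j)).
by rewrite distrC.
Qed.

Lemma continuous_measurable_rV (R : realType) n (f : 'rV[R]_n -> R) :
  continuous f -> measurable_fun setT f.
Proof.
move=> /continuousP cf; apply: (measurability _ (RGenOpens.measurableE R)).
move=> _ [_ [a [b ->] <-]]; rewrite setTI; apply: open_measurable_rV.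
exact/cf/interval_open.
Qed.

Section euclidean.
Context {R : realType} {n : nat}.
Implicit Types (x y z : 'rV[R]_n) (t : R).

Definition dotv x y : R := \sum_(i < n) x ord0 i * y ord0 i.

Lemma dotvC x y : dotv x y = dotv y x.
Proof. by apply: eq_bigr => i _; rewrite mulrC. Qed.

Lemma dotvDl x y z : dotv (x + y) z = dotv x z + dotv y z.
Proof. by rewrite -big_split/=; apply: eq_bigr => i _; rewrite mxE mulrDl. Qed.

Lemma dotvZl t x y : dotv (t *: x) y = t * dotv x y.
Proof. by rewrite mulr_sumr; apply: eq_bigr => i _; rewrite mxE mulrA. Qed.

Lemma dotvNl x y : dotv (- x) y = - dotv x y.
Proof. by rewrite -scaleN1r dotvZl mulN1r. Qed.

Lemma dotvDr x y z : dotv z (x + y) = dotv z x + dotv z y.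
Proof. by rewrite dotvC dotvDl !(dotvC z). Qed.

Lemma dotvZr t x y : dotv x (t *: y) = t * dotv x y.
Proof. by rewrite dotvC dotvZl dotvC. Qed.

Lemma dotvNr x y : dotv x (- y) = - dotv x y.
Proof. by rewrite dotvC dotvNl dotvC. Qed.

Lemma dot0v x : dotv 0 x = 0.
Proof. by rewrite -(scale0r (0 : 'rV_n)) dotvZl mul0r. Qed.

Definition dotvE := (dotvDl, dotvDr, dotvNl, dotvNr, dotvZl, dotvZr).

Lemma dotvv_ge0 x : 0 <= dotv x x.
Proof. by apply: sumr_ge0 => i _; rewrite -expr2 sqr_ge0. Qed.

Lemma dotvv_eq0 x : (dotv x x == 0) = (x == 0).
Proof.
apply/idP/eqP => [|->]; last by rewrite dot0v.
rewrite psumr_eq0 => [/allP x0|i _]; last by rewrite -expr2 sqr_ge0.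
apply/rowP => i; rewrite mxE; apply/eqP.
by have := x0 i (mem_index_enum i); rewrite mulf_eq0 orbb.
Qed.

Lemma dotvv_gt0 x : x != 0 -> 0 < dotv x x.
Proof. by move=> x0; rewrite lt_def dotvv_ge0 dotvv_eq0 x0. Qed.

Lemma enormE x : enorm x = Num.sqrt (dotv x x).
Proof. by congr Num.sqrt; apply: eq_bigr => i _; rewrite expr2. Qed.

Lemma enorm_sqr x : enorm x ^+ 2 = dotv x x.
Proof. by rewrite enormE sqr_sqrtr// dotvv_ge0. Qed.

Lemma enorm_ge0 x : 0 <= enorm x.
Proof. by rewrite enormE sqrtr_ge0. Qed.

Lemma enorm_gt0 x : x != 0 -> 0 < enorm x.
Proof. by move=> x0; rewrite enormE sqrtr_gt0 dotvv_gt0. Qed.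

Lemma enorm0 : enorm (0 : 'rV[R]_n) = 0.
Proof. by rewrite enormE dot0v sqrtr0. Qed.

Lemma enormZ t x : enorm (t *: x) = `|t| * enorm x.
Proof. by rewrite !enormE !dotvE mulrA -expr2 sqrtrM ?sqr_ge0// sqrtr_sqr. Qed.

Lemma enorm_powR x p : enorm x `^ p = dotv x x `^ (p / 2).
Proof. by rewrite enormE -powR12_sqrt ?dotvv_ge0// -powRrM mulrC. Qed.

(** Cauchy-Schwarz: expand the squared norm of [|x|^2 y - (x . y) x], which is [|x|^2] times the
    component of [y] orthogonal to [x]. *)
Lemma dotv_le_enorm x y : `|dotv x y| <= enorm x * enorm y.
Proof.
rewrite -ler_sqr ?nnegrE ?mulr_ge0 ?enorm_ge0//.
rewrite exprMn !enorm_sqr real_normK ?num_real//.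
have [->|x0] := eqVneq x 0; first by rewrite !dot0v expr0n mul0r.
have := dotvv_ge0 (dotv x x *: y - dotv x y *: x).
rewrite !dotvE (dotvC y x) => h.
rewrite -(ler_pM2l (dotvv_gt0 x0)); nra.
Qed.

Lemma enormD x y : enorm (x + y) <= enorm x + enorm y.
Proof.
rewrite -ler_sqr ?nnegrE ?addr_ge0 ?enorm_ge0//.
rewrite sqrrD !enorm_sqr !dotvE (dotvC y x).
have := dotv_le_enorm x y; rewrite ler_norml => /andP[_]; lra.
Qed.

Lemma enormN x : enorm (- x) = enorm x.
Proof. by rewrite -scaleN1r enormZ normrN1 mul1r. Qed.

Lemma cvg_dotv T (F : set_system T) {FF : Filter F} (f g : T -> 'rV[R]_n)
    (a b : 'rV[R]_n) : f @ F --> a -> g @ F --> b ->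
  dotv (f x) (g x) @[x --> F] --> dotv a b.
Proof.
move=> fa gb; apply: cvg_big => //=; first exact: add_continuous.
move=> i _; apply: cvgM.
  exact: (cvg_comp _ _ fa (@coord_continuous _ _ _ ord0 i a)).
exact: (cvg_comp _ _ gb (@coord_continuous _ _ _ ord0 i b)).
Qed.

Lemma continuous_dotvv : continuous (fun x => dotv x x).
Proof. by move=> x; apply: (@cvg_dotv _ _ (nbhs_filter x) id id x x) => A. Qed.

Lemma continuous_enorm : continuous (@enorm R n).
Proof.
move=> x; rewrite (_ : @enorm R n = fun x => Num.sqrt (dotv x x)).
  apply: (@continuous_comp _ _ _ (fun x => dotv x x) Num.sqrt x).
    exact: continuous_dotvv.
  exact: sqrt_continuous.
by apply/funext => y; rewrite enormE.
Qed.

Lemma measurable_enorm : measurable_fun setT (@enorm R n).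
Proof. apply: continuous_measurable_rV; exact: continuous_enorm. Qed.

Lemma measurable_dotv z : measurable_fun setT (dotv z).
Proof.
apply: continuous_measurable_rV => x.
by apply: (@cvg_dotv _ _ (nbhs_filter x) (cst z) id z x); [exact: cvg_cst|].
Qed.

Lemma coord_le_enorm x i : `|x ord0 i| <= enorm x.
Proof.
rewrite enormE -sqrtr_sqr ler_wsqrtr// /dotv (bigD1 i)//= expr2 lerDl.
by apply: sumr_ge0 => j _; rewrite -expr2 sqr_ge0.
Qed.

(** The inversion in the unit sphere. As [0^-1 = 0] it fixes the origin, so [dotv_sinv] and [sinvZ]
    hold without exception. *)
Definition sinv x := (dotv x x)^-1 *: x.

Lemma dotv_sinv x : dotv (sinv x) (sinv x) = (dotv x x)^-1.
Proof.
have [->|x0] := eqVneq x 0; first by rewrite /sinv scaler0 dot0v invr0.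
by rewrite /sinv !dotvE; field; rewrite gt_eqF// dotvv_gt0.
Qed.

Lemma enorm_sinv x : enorm (sinv x) = (enorm x)^-1.
Proof. by rewrite !enormE dotv_sinv sqrtrV// dotvv_ge0. Qed.

Lemma sinvZ t x : sinv (t *: x) = t^-1 *: sinv x.
Proof.
have [->|t0] := eqVneq t 0; first by rewrite invr0 !scale0r /sinv scaler0.
have [->|x0] := eqVneq x 0; first by rewrite /sinv !scaler0.
rewrite /sinv !dotvE !scalerA; congr (_ *: _); field.
by rewrite t0 gt_eqF// dotvv_gt0.
Qed.

Lemma measurable_sinv : measurable_fun setT sinv.
Proof.
apply: measurable_fun_rV => i; under eq_fun do rewrite mxE.
apply: measurable_funM; last exact: measurable_coord.
(* The inverse is read as the power [-1], which is measurable on the whole line. *)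
under eq_fun do rewrite -powR_inv1 ?dotvv_ge0//.
apply: (measurableT_comp (measurable_powR (-1))).
apply: continuous_measurable_rV; exact: continuous_dotvv.
Qed.

End euclidean.

Lemma cvg_powR (R : realType) T (F : set_system T) {FF : Filter F}
    (f : T -> R) (a p : R) : 0 < a -> f @ F --> a ->
  f x `^ p @[x --> F] --> a `^ p.
Proof.
move=> a0 fa; apply: (@continuous_cvg _ _ _ _ FF f (fun x : R => x `^ p)) => //.
apply: differentiable_continuous; apply/derivable1_diffP.
by apply: derivable_powR; rewrite in_itv/= a0.
Qed.

(** * The Jacobian of the inversion *)

Section inversion.
Context {R : realType} {n : nat}.
Hypothesis n0 : (0 < n)%N.
Local Notation mu := (lebesgue_rV R n).
Local Open Scope ereal_scope.

(** On R^0 the origin has mass 1, hence [n0]. *)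
Lemma lebesgue_rV_set0 : mu [set (0 : 'rV[R]_n)%R] = 0.
Proof.
have := @lebesgue_rV_box R n (fun=> [set 0%R]) (fun=> measurable_set1 _).
rewrite (_ : [set x | _] = [set 0%R]).
  move=> ->; case: n n0 => // k _; rewrite big_ord_recl.
  by rewrite lebesgue_measure_set1 mul0e.
apply/seteqP; split => [x /= x0|_ -> i /=]; last by rewrite mxE.
by apply/rowP => i; rewrite x0 mxE.
Qed.

(** Disposes of the origin, where formulas involving the inversion take default values. *)
Lemma ge0_integral_rV_neq0 (f g : 'rV[R]_n -> \bar R) :
  measurable_fun setT f -> measurable_fun setT g ->
  (forall x, 0 <= f x) -> (forall x, 0 <= g x) ->
  (forall x, x != 0%R -> f x = g x) ->
  \int[mu]_x f x = \int[mu]_x g x.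
Proof.
move=> mf mg f0 g0 fg; apply: ge0_ae_eq_integral => //.
exists [set 0%R]; split.
- rewrite (_ : [set 0%R] = setT `&` @enorm R n @^-1` [set 0%R]).
    exact: measurable_enorm.
  rewrite setTI; apply/seteqP; split => [_ -> /=|x /= x0]; first exact: enorm0.
  by apply/eqP; rewrite -dotvv_eq0 -enorm_sqr x0 expr0n.
- exact: lebesgue_rV_set0.
move=> x /= /not_implyP[_ fgx]; apply: contrapT => /eqP x0; exact/fgx/fg.
Qed.

(* The measure dx / |x|^n is invariant under dilations. Smearing it along the
   dilation orbits with the window [phi], of total mass 1 in [s], turns the
   inversion into the reflection [s |-> - s] followed by a translation. *)
Let w (x : 'rV[R]_n) : \bar R := ((enorm x ^+ n)^-1)%:E.
Let phi (x : 'rV[R]_n) s : \bar R := (\1_(`[0%R, 1%R]) (ln (enorm x) - s)%R)%:E.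

Let measurable_w : measurable_fun setT w.
Proof.
apply/measurable_EFinP.
under eq_fun do rewrite -powR_invn ?enorm_ge0//.
by apply: (measurableT_comp (measurable_powR _)); exact: measurable_enorm.
Qed.

Let measurable_ln_enorm :
  measurable_fun setT (fun x : 'rV[R]_n => ln (enorm x)).
Proof.
by apply: (measurableT_comp (@measurable_ln R)); exact: measurable_enorm.
Qed.

Let measurable_exp_scale :
  measurable_fun setT (fun p : R * 'rV[R]_n => expR p.1 *: p.2)%R.
Proof.
apply: measurable_fun_rV => i; under eq_fun do rewrite mxE.
apply: measurable_funM.
  exact: (measurableT_comp (@measurable_expR R) measurable_fst).
exact: (measurableT_comp (@measurable_coord _ (measurableTypeR R) n i)
  measurable_snd).
Qed.

Let integral_phi x : \int[lebesgue_measure]_s phi x s = 1.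
Proof.
pose g (s : R) : \bar R := (\1_(`[0%R, 1%R]) s)%:E.
have mg : measurable_fun [set: R] g.
  by apply/measurable_EFinP; exact: measurable_indic.
have g0 s : 0 <= g s by rewrite lee_fin.
have mgD : measurable_fun [set: R] (fun s => g (s + ln (enorm x))%R).
  by apply: (measurableT_comp mg); exact: measurable_funD.
transitivity (\int[lebesgue_measure]_s g (- s + ln (enorm x))%R).
  by apply: eq_integral => s _; rewrite addrC.
rewrite (ge0_integral_opp (f := fun s => g (s + ln (enorm x))%R))//.
rewrite ge0_integral_shift// /g integral_indic// setIT.
rewrite [LHS](lebesgue_measure_itv `[0%R, 1%R])/=.
by rewrite lte_fin ltr01 -EFinB subr0.
Qed.

Let measurable_phi : measurable_fun setT (fun p : R * 'rV[R]_n => phi p.2 p.1).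
Proof.
apply/measurable_EFinP; apply: (measurableT_comp (measurable_indic _)) => //.
apply: measurable_funB => //.
exact: (measurableT_comp measurable_ln_enorm).
Qed.

(** Insert [1 = \int phi x s ds], exchange the integrals and replace [x] by [expR s *: x]: the
    measure [w x dx] is invariant and [phi (expR s *: x) s = phi x 0], so that only [H] still
    depends on [s]. *)
Let integral_log_polar (H : 'rV[R]_n -> \bar R) :
  measurable_fun setT H -> (forall x, 0 <= H x) ->
  \int[mu]_x (w x * H x) =
  \int[mu]_x (w x * phi x 0 * \int[lebesgue_measure]_s H (expR s *: x)%R).
Proof.
move=> mH H0.
have w0 x : 0 <= w x by rewrite lee_fin invr_ge0 exprn_ge0// enorm_ge0.
have phi0 x s : 0 <= phi x s by rewrite lee_fin.
have mwH : measurable_fun setT (fun x => w x * H x) by exact: emeasurable_funM.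
have mF : measurable_fun setT (fun p : R * 'rV[R]_n =>
    w p.2 * H p.2 * phi p.2 p.1).
  by apply: emeasurable_funM => //; exact: (measurableT_comp mwH).
have mG : measurable_fun setT (fun p : R * 'rV[R]_n =>
    w p.2 * phi p.2 0 * H (expR p.1 *: p.2)%R).
  apply: emeasurable_funM; last exact: (measurableT_comp mH).
  apply: emeasurable_funM; first exact: (measurableT_comp measurable_w).
  apply: (measurableT_comp measurable_phi
    (g := fun p => (0%R, p.2) : R * 'rV[R]_n)).
  exact: measurable_fun_pair.
transitivity (\int[mu]_x \int[lebesgue_measure]_s (w x * H x * phi x s)).
  apply: eq_integral => x _; rewrite ge0_integralZl ?integral_phi ?mule1//.
  - exact: (measurableT_comp measurable_phi (pair2_measurable x)).
  - by rewrite mule_ge0.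
rewrite -(@fubini_tonelli _ _ _ _ R lebesgue_measure mu
  (fun p => w p.2 * H p.2 * phi p.2 p.1))//; last first.
  by move=> p; rewrite !mule_ge0.
transitivity (\int[mu]_x \int[lebesgue_measure]_s
    (w x * phi x 0 * H (expR s *: x)%R)); last first.
  apply: eq_integral => x _; rewrite ge0_integralZl//.
  - exact: (measurableT_comp (measurableT_comp mH measurable_exp_scale)
      (pair2_measurable x)).
  - by rewrite mule_ge0.
rewrite -(@fubini_tonelli _ _ _ _ R lebesgue_measure mu
  (fun p => w p.2 * phi p.2 0 * H (expR p.1 *: p.2)%R))//; last first.
  by move=> p; rewrite !mule_ge0.
apply: eq_integral => s _ /=.
rewrite -(ge0_integral_rV_dilation (expR_gt0 s))//; last 2 first.
- exact: (measurableT_comp mF (pair1_measurable s)).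
- by move=> x; rewrite !mule_ge0.
have mFs : measurable_fun setT
    (fun x : 'rV[R]_n => (s, expR s *: x)%R : R * 'rV[R]_n).
  by apply: measurable_fun_pair => //; exact: measurable_rV_dilation.
rewrite -ge0_integralZl//; last 2 first.
- exact: (measurableT_comp mF mFs).
- by move=> x _; rewrite !mule_ge0.
apply: eq_integral => x _.
(* At the origin [w] is 0, because [n > 0] and [0^-1 = 0]. *)
have [->|x0] := eqVneq x 0%R.
  by rewrite /w scaler0 enorm0 expr0n gtn_eqF//= invr0 !mul0e mule0.
rewrite /w /phi enormZ gtr0_norm ?expR_gt0// lnM ?posrE ?expR_gt0 ?enorm_gt0//.
rewrite expRK subr0 addrAC subrr add0r.
rewrite -(muleA _ (H _)) (muleC (H _)) !muleA -!EFinM.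
congr (_%:E * _); congr (_ * _)%R.
rewrite exprMn; field.
by rewrite !expf_neq0// gt_eqF ?expR_gt0// enorm_gt0.
Qed.

Let integral_w_sinv (H : 'rV[R]_n -> \bar R) :
  measurable_fun setT H -> (forall x, 0 <= H x) ->
  \int[mu]_x (w x * H (sinv x)) = \int[mu]_x (w x * H x).
Proof.
move=> mH H0.
have mHi : measurable_fun setT (fun x => H (sinv x)).
  by apply: (measurableT_comp mH); exact: measurable_sinv.
rewrite integral_log_polar// [RHS]integral_log_polar//.
apply: eq_integral => x _; congr (_ * _).
have [->|x0] := eqVneq x 0%R.
  by apply: eq_integral => s _; rewrite /sinv !scaler0.
have mHs y : measurable_fun [set: R] (fun s => H (expR s *: y)%R).
  exact: (measurableT_comp (measurableT_comp mH measurable_exp_scale)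
      (pair2_measurable y)).
transitivity (\int[lebesgue_measure]_s H (expR (- s) *: sinv x)%R).
  by apply: eq_integral => s _; rewrite sinvZ expRN.
rewrite (ge0_integral_opp (f := fun s => H (expR s *: sinv x)%R))//.
(* [sinv x] lies on the dilation orbit of [x], at parameter [- ln (dotv x x)]. *)
rewrite -[RHS](ge0_integral_shift (- ln (dotv x x)))//.
apply: eq_integral => s _; congr H.
by rewrite /sinv scalerA expRD expRN lnK// posrE dotvv_gt0.
Qed.

(** The Jacobian is [|x|^(- 2 n)]. With [H x = |x|^n f x], the left integrand is [w x * H (sinv x)],
    and [w x * H x] is [f x] off the origin. *)
Theorem ge0_integral_sinv (f : 'rV[R]_n -> \bar R) :
  measurable_fun setT f -> (forall x, 0 <= f x) ->
  \int[mu]_x (((dotv x x) ^+ n)^-1%:E * f (sinv x)) = \int[mu]_x f x.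
Proof.
move=> mf f0.
pose H x := (enorm x ^+ n)%:E * f x.
have mH : measurable_fun setT H.
  apply: emeasurable_funM => //; apply/measurable_EFinP.
  by apply: measurable_funX; exact: measurable_enorm.
have H0 x : 0 <= H x by rewrite mule_ge0// lee_fin exprn_ge0// enorm_ge0.
have mHi : measurable_fun setT (fun x => H (sinv x)).
  by apply: (measurableT_comp mH); exact: measurable_sinv.
have w0 x : 0 <= w x by rewrite lee_fin invr_ge0 exprn_ge0// enorm_ge0.
transitivity (\int[mu]_x (w x * H (sinv x))).
  apply: eq_integral => x _; rewrite /w /H enorm_sinv muleA -EFinM.
  by rewrite -enorm_sqr -exprM mulnC exprM expr2 invfM exprVn.
rewrite integral_w_sinv//; apply: ge0_integral_rV_neq0 => //.
- exact: emeasurable_funM.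
- by move=> x; rewrite mule_ge0.
move=> x x0; rewrite /w /H muleA -EFinM mulVf ?mul1e//.
by rewrite expf_neq0// gt_eqF// enorm_gt0.
Qed.

End inversion.

(** * Folding R^n onto the unit ball *)

Section kernels.
Context {R : realType} {n : nat}.
Implicit Types (x y z : 'rV[R]_n).

(** The squared distance, expanded in inner products so that its relations with [invdistsq] are
    polynomial identities. *)
Definition distsq y z : R := dotv z z - 2 * dotv y z + dotv y y.

(* [|y|^2 |z - y / |y|^2|^2], written so as to make sense at [y = 0]. *)
Definition invdistsq y z : R := 1 - 2 * dotv y z + dotv y y * dotv z z.

Lemma distsqE y z : distsq y z = dotv (z - y) (z - y).
Proof. by rewrite /distsq !dotvE (dotvC z y); ring. Qed.

Lemma distsq_ge0 y z : 0 <= distsq y z.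
Proof. by rewrite distsqE dotvv_ge0. Qed.

Lemma invdistsq_ge y z : (1 - enorm y * enorm z) ^+ 2 <= invdistsq y z.
Proof.
rewrite /invdistsq -!enorm_sqr; have := dotv_le_enorm y z.
rewrite ler_norml => /andP[_]; nra.
Qed.

Lemma invdistsq_le y z : invdistsq y z <= (1 + enorm y * enorm z) ^+ 2.
Proof.
rewrite /invdistsq -!enorm_sqr; have := dotv_le_enorm y z.
rewrite ler_norml => /andP[+ _]; nra.
Qed.

Lemma invdistsq_ge0 y z : 0 <= invdistsq y z.
Proof. by apply: le_trans (invdistsq_ge y z); exact: sqr_ge0. Qed.

(** The source of [K > A] inside the ball, where both factors are positive, and of [K = A] on the
    sphere. *)
Lemma invdistsqB y z :
  invdistsq y z - distsq y z = (1 - dotv y y) * (1 - dotv z z).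
Proof. by rewrite /invdistsq /distsq; ring. Qed.

(** Inverting [z] exchanges [distsq] and [invdistsq] up to [|z|^2]: this is why folding turns each
    kernel into the other. *)
Lemma distsq_sinvr y z : z != 0 ->
  distsq y (sinv z) = invdistsq y z / dotv z z.
Proof.
move=> z0; rewrite /distsq /invdistsq dotv_sinv /sinv dotvZr; field.
by rewrite gt_eqF// dotvv_gt0.
Qed.

Lemma invdistsq_sinvr y z : z != 0 ->
  invdistsq y (sinv z) = distsq y z / dotv z z.
Proof.
move=> z0; rewrite /distsq /invdistsq dotv_sinv /sinv dotvZr; field.
by rewrite gt_eqF// dotvv_gt0.
Qed.

Lemma distsq_sinvl y z : y != 0 ->
  distsq (sinv y) z = invdistsq y z / dotv y y.
Proof.
move=> y0; rewrite /distsq /invdistsq dotv_sinv /sinv dotvZl; field.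
by rewrite gt_eqF// dotvv_gt0.
Qed.

Lemma measurable_distsq y : measurable_fun setT (distsq y).
Proof.
apply: measurable_funD => //; apply: measurable_funB.
  by apply: continuous_measurable_rV; exact: continuous_dotvv.
by apply: measurable_funM => //; exact: measurable_dotv.
Qed.

Lemma measurable_invdistsq y : measurable_fun setT (invdistsq y).
Proof.
apply: measurable_funD.
  apply: measurable_funB => //; apply: measurable_funM => //.
  exact: measurable_dotv.
apply: measurable_funM => //.
by apply: continuous_measurable_rV; exact: continuous_dotvv.
Qed.

End kernels.

Section fold.
Context {R : realType} {n : nat}.
Hypothesis n0 : (0 < n)%N.
Local Notation mu := (lebesgue_rV R n).
Local Open Scope ereal_scope.

Definition oball : set 'rV[R]_n := [set z | dotv z z < 1]%R.
Definition usphere : set 'rV[R]_n := [set z | dotv z z = 1]%R.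

Let measurable_dotvv : measurable_fun setT (fun z : 'rV[R]_n => dotv z z).
Proof. by apply: continuous_measurable_rV; exact: continuous_dotvv. Qed.

Lemma measurable_oball : measurable oball.
Proof.
rewrite (_ : oball = setT `&` (fun z => dotv z z) @^-1` `]-oo, 1%R[).
  exact: measurable_dotvv.
by rewrite setTI; apply/seteqP; split => z /=; rewrite in_itv.
Qed.

Lemma measurable_usphere : measurable usphere.
Proof.
rewrite (_ : usphere = setT `&` (fun z => dotv z z) @^-1` [set 1%R]).
  exact: measurable_dotvv.
by rewrite setTI.
Qed.

(** The sphere keeps its own term: the two kernels agree there, so it is the same on both sides of
    [kelvin_identity]. *)
Lemma ge0_integral_fold (f : 'rV[R]_n -> \bar R) :
  measurable_fun setT f -> (forall x, 0 <= f x) ->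
  \int[mu]_x f x = \int[mu]_(x in usphere) f x + \int[mu]_(x in oball) f x +
    \int[mu]_(x in oball) ((dotv x x ^+ n)^-1%:E * f (sinv x)).
Proof.
move=> mf f0.
pose out : set 'rV[R]_n := ~` (usphere `|` oball).
have mU : measurable (usphere `|` oball).
  by apply: measurableU; [exact: measurable_usphere|exact: measurable_oball].
have mout : measurable out by exact: measurableC.
have mfo : measurable_fun setT (f \_ out).
  apply: (measurable_restrictT f mout).1.
  by apply: measurable_funTS.
have -> : \int[mu]_x f x =
    \int[mu]_(x in usphere `|` oball) f x + \int[mu]_(x in out) f x.
  rewrite -[in LHS](setUv (usphere `|` oball)) ge0_integral_setU//.
    by rewrite setUv.
  by rewrite disj_set2E setICr.
congr (_ + _).
  rewrite ge0_integral_setU//.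
  - exact: measurable_usphere.
  - exact: measurable_oball.
  - exact: measurable_funTS.
  - rewrite disj_set2E; apply/eqP/seteqP; split => // z [/= z1].
    by rewrite /oball/= z1 ltxx.
rewrite integral_mkcond -ge0_integral_sinv//; last first.
  by move=> x; rewrite patchE; case: ifP.
rewrite [RHS]integral_mkcond; apply: eq_integral => x _.
(* At the origin both sides vanish, the weight being [0^-1 = 0]. *)
rewrite !patchE; have [->|x0] := eqVneq x 0%R.
  by rewrite dot0v expr0n gtn_eqF//= invr0 !mul0e if_same.
have xx0 := dotvv_gt0 x0.
have -> : (sinv x \in out) = (x \in oball).
  have outE : out (sinv x) <-> (1 < (dotv x x)^-1)%R.
    rewrite /out /usphere /oball/= dotv_sinv.
    split=> [/not_orP[h1 /negP h2]|h [e|/(lt_trans h)]].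
    - by rewrite lt_neqAle eq_sym leNgt h2 andbT; apply/eqP.
    - by rewrite e ltxx in h.
    - by rewrite ltxx.
  apply/idP/idP => [/set_mem/outE|/set_mem h].
    by rewrite invf_gt1// => h; exact/mem_set.
  by apply/mem_set/outE; rewrite invf_gt1.
by case: ifP => //; rewrite mule0.
Qed.

End fold.

Lemma powR_invl (R : realType) (a r : R) : 0 <= a -> a^-1 `^ r = (a `^ r)^-1.
Proof. by move=> a0; rewrite -powR_inv1// -powRrM mulN1r powRN. Qed.

(** * The kernels and the Kelvin identity on the unit ball *)

Section fold_identity.
Context {R : realType} {n : nat} (p q : R).
Hypotheses (n0 : (0 < n)%N) (p0 : 0 < p) (pq : p * q = p + n%:R * 2).
Local Notation mu := (lebesgue_rV R n).
Implicit Types (x y z : 'rV[R]_n) (u v : 'rV[R]_n -> R).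

Definition kerA y z := distsq y z `^ (p / 2).

Definition kerK y z := invdistsq y z `^ (p / 2).

Definition riesz u v := forall y,
  ((u y)%:E = \int[mu]_z (kerA y z * v z `^ (- q))%:E)%E.

(** A relation off the origin only: at [z = 0] the formula would give 0, whereas the value wanted
    there is the limit, supplied by [ktrans]. *)
Definition kelvin u us := forall z,
  z != 0 -> us z = dotv z z `^ (p / 2) * u (sinv z).

Lemma kerA_ge0 y z : 0 <= kerA y z. Proof. exact: powR_ge0. Qed.

Lemma kerK_ge0 y z : 0 <= kerK y z. Proof. exact: powR_ge0. Qed.

Lemma kerA_le_kerK y z : dotv y y <= 1 -> dotv z z <= 1 ->
  kerA y z <= kerK y z.
Proof.
move=> y1 z1; apply: ge0_ler_powR; rewrite ?nnegrE ?distsq_ge0 ?invdistsq_ge0//.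
  by rewrite divr_ge0// ltW.
by rewrite -subr_ge0 invdistsqB mulr_ge0// subr_ge0.
Qed.

Lemma kerA_lt_kerK y z : dotv y y < 1 -> dotv z z < 1 ->
  kerA y z < kerK y z.
Proof.
move=> y1 z1; apply: gt0_ltr_powR; rewrite ?nnegrE ?distsq_ge0 ?invdistsq_ge0//.
  by rewrite divr_gt0.
by rewrite -subr_gt0 invdistsqB mulr_gt0// subr_gt0.
Qed.

Lemma kerA_usphere y z : usphere z -> kerA y z = kerK y z.
Proof.
move=> z1; congr (_ `^ _); apply/eqP; rewrite eq_sym -subr_eq0 invdistsqB.
by rewrite z1 subrr mulr0.
Qed.

Lemma measurable_kerA y : measurable_fun setT (kerA y).
Proof.
by apply: (measurableT_comp (measurable_powR _)); exact: measurable_distsq.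
Qed.

Lemma measurable_kerK y : measurable_fun setT (kerK y).
Proof.
by apply: (measurableT_comp (measurable_powR _)); exact: measurable_invdistsq.
Qed.

Lemma measurable_kerv (k f : 'rV[R]_n -> R) :
  measurable_fun setT k -> measurable_fun setT f ->
  measurable_fun setT (fun z => (k z * f z `^ (- q))%:E).
Proof.
move=> mk mf; apply/measurable_EFinP; apply: measurable_funM => //.
exact: (measurableT_comp (measurable_powR _)).
Qed.

Section weights.
Variables v vs : 'rV[R]_n -> R.
Hypotheses (v0 : forall z, 0 < v z) (vvs : kelvin v vs).

(** Since [p q = p + 2 n], the factor [|z|^(p q)] splits into [|z|^p], absorbed by the kernel, and
    [|z|^(2 n)], which cancels the Jacobian. *)
Let kelvin_powR z : z != 0 ->
  v (sinv z) `^ (- q) = vs z `^ (- q) * (dotv z z `^ (p / 2) * dotv z z ^+ n).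
Proof.
move=> z0; have zz0 := dotvv_gt0 z0.
rewrite vvs// [in RHS]powRM ?powR_ge0//; last exact/ltW/v0.
have E : (dotv z z `^ (p / 2)) `^ (- q) = dotv z z `^ (p / 2 * - q).
  by rewrite [RHS]powRrM.
rewrite E -(powR_mulrn _ (ltW zz0)).
rewrite mulrAC -!powRD ?(gt_eqF zz0) ?implybT//.
rewrite (_ : _ + _ = 0) ?powRr0 ?mul1r//.
by move: pq; nra.
Qed.

Lemma kelvin_kerA y z : z != 0 ->
  (dotv z z ^+ n)^-1 * (kerA y (sinv z) * v (sinv z) `^ (- q)) =
  kerK y z * vs z `^ (- q).
Proof.
move=> z0; have zz0 := dotvv_gt0 z0.
rewrite kelvin_powR// /kerA /kerK distsq_sinvr//.
rewrite powRM ?invdistsq_ge0 ?invr_ge0 ?ltW//.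
rewrite powR_invl ?ltW//; field.
by rewrite !gt_eqF ?exprn_gt0// powR_gt0.
Qed.

Lemma kelvin_kerK y z : z != 0 ->
  (dotv z z ^+ n)^-1 * (kerK y (sinv z) * v (sinv z) `^ (- q)) =
  kerA y z * vs z `^ (- q).
Proof.
move=> z0; have zz0 := dotvv_gt0 z0.
rewrite kelvin_powR// /kerA /kerK invdistsq_sinvr//.
rewrite powRM ?distsq_ge0 ?invr_ge0 ?ltW//.
rewrite powR_invl ?ltW//; field.
by rewrite !gt_eqF ?exprn_gt0// powR_gt0.
Qed.

Hypotheses (mv : measurable_fun setT v) (mvs : measurable_fun setT vs).

(** Stated for any two kernels exchanged by the inversion, to serve for [kerA, kerK] and for
    [kerK, kerA]. *)
Let ker_fold (k k' : 'rV[R]_n -> R) :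
  measurable_fun setT k -> measurable_fun setT k' ->
  (forall z, 0 <= k z) -> (forall z, 0 <= k' z) ->
  (forall z, z != 0 ->
    (dotv z z ^+ n)^-1 * (k (sinv z) * v (sinv z) `^ (- q)) =
    k' z * vs z `^ (- q)) ->
  (\int[mu]_z (k z * v z `^ (- q))%:E =
   \int[mu]_(z in usphere) (k z * v z `^ (- q))%:E +
   \int[mu]_(z in oball) (k z * v z `^ (- q))%:E +
   \int[mu]_(z in oball) (k' z * vs z `^ (- q))%:E)%E.
Proof.
move=> mk mk' k0 k'0 kk'.
have mkv := measurable_kerv mk mv.
have mkvs := measurable_kerv mk' mvs.
rewrite ge0_integral_fold//; last first.
  by move=> z; rewrite lee_fin mulr_ge0// powR_ge0.
congr (_ + _)%E.
rewrite integral_mkcond [RHS]integral_mkcond.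
have mB := @measurable_oball R n.
pose kv (z : 'rV[R]_n) : \bar R :=
  ((dotv z z ^+ n)^-1 * (k (sinv z) * v (sinv z) `^ (- q)))%:E.
have mkv' : measurable_fun setT kv.
  apply/measurable_EFinP; apply: measurable_funM.
    under eq_fun do rewrite -powR_invn ?dotvv_ge0//.
    apply: (measurableT_comp (measurable_powR _)).
    by apply: continuous_measurable_rV; exact: continuous_dotvv.
  exact: (measurableT_comp ((measurable_EFinP _ _).1 mkv)
    (@measurable_sinv R n)).
apply: ge0_integral_rV_neq0 => //.
- by apply: (measurable_restrictT _ mB).1; exact: (measurable_funTS (f := kv)).
- by apply: (measurable_restrictT _ mB).1; exact: measurable_funTS.
- move=> z; rewrite patchE; case: ifP => // _.
  rewrite -EFinM lee_fin !mulr_ge0 ?powR_ge0//.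
  by rewrite invr_ge0 exprn_ge0// dotvv_ge0.
- move=> z; rewrite patchE; case: ifP => // _.
  by rewrite lee_fin mulr_ge0// powR_ge0.
- by move=> z z0; rewrite !patchE; case: ifP => // _; rewrite -EFinM kk'.
Qed.

(* This is [u + I(v) = us + I(vs)], where [I] integrates against [K - A] over the
   ball. Both integrals are kept on the positive side because the equality is one
   of extended reals. *)
Lemma kelvin_identity y : dotv y y <= 1 ->
  (\int[mu]_z (kerA y z * v z `^ (- q))%:E +
   \int[mu]_(z in oball) ((kerK y z - kerA y z) * v z `^ (- q))%:E =
   \int[mu]_z (kerK y z * v z `^ (- q))%:E +
   \int[mu]_(z in oball) ((kerK y z - kerA y z) * vs z `^ (- q))%:E)%E.
Proof.
move=> y1.
have regroup (s a b c d : \bar R) :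
    (s + a + (c + d) + b = s + (a + b) + c + d)%E.
  by rewrite !addeA (addeAC _ d b) (addeAC _ c b).
have mA := measurable_kerA y; have mK := measurable_kerK y.
have mD : measurable_fun setT (fun z => kerK y z - kerA y z).
  exact: measurable_funB.
have mB := @measurable_oball R n.
have splitK (f : 'rV[R]_n -> R) : measurable_fun setT f ->
    (\int[mu]_(z in oball) (kerK y z * f z `^ (- q))%:E =
     \int[mu]_(z in oball) (kerA y z * f z `^ (- q))%:E +
     \int[mu]_(z in oball) ((kerK y z - kerA y z) * f z `^ (- q))%:E)%E.
  move=> mf; rewrite -ge0_integralD//.
  - by apply: eq_integral => z _; rewrite -EFinD -mulrDl addrC subrK.
  - by move=> z _; rewrite lee_fin mulr_ge0 ?powR_ge0.
  - by apply: measurable_funTS; exact: measurable_kerv.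
  - move=> z z1; rewrite lee_fin mulr_ge0 ?powR_ge0// subr_ge0 kerA_le_kerK//.
    exact: ltW.
  - by apply: measurable_funTS; exact: measurable_kerv.
(* Once folded, and with [K] split as [A + (K - A)], both sides are the sphere term plus the ball
   integrals of [A] and of [K - A] against [v^(- q)] and [vs^(- q)]. *)
rewrite (ker_fold mA mK (kerA_ge0 y) (kerK_ge0 y) (kelvin_kerA y)).
rewrite (ker_fold mK mA (kerK_ge0 y) (kerA_ge0 y) (kelvin_kerK y)).
rewrite (splitK v mv) (splitK vs mvs).
rewrite (_ : \int[mu]_(z in usphere) (kerK y z * v z `^ (- q))%:E =
  \int[mu]_(z in usphere) (kerA y z * v z `^ (- q))%:E)%E; last first.
  by apply: eq_integral => z /set_mem z1; rewrite kerA_usphere.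
exact: regroup.
Qed.

End weights.

End fold_identity.

(** * Invariance of the integral system *)

Lemma sqr_powR_half (R : realType) (x p : R) : 0 <= x ->
  (x ^+ 2) `^ (p / 2) = x `^ p.
Proof.
move=> x0; rewrite -powR_mulrn// -[LHS]powRrM; congr (_ `^ _); lra.
Qed.

Lemma cvg_sinv (R : realType) n T (F : set_system T) {FF : Filter F}
    (f : T -> 'rV[R]_n) (y : 'rV[R]_n) : y != 0 ->
  f @ F --> y -> sinv (f x) @[x --> F] --> sinv y.
Proof.
move=> y0 fy; rewrite /sinv; apply: cvgZ => //.
apply: (@cvgV _ _ _ _ (fun x => dotv (f x) (f x))); last exact: cvg_dotv.
by rewrite gt_eqF// dotvv_gt0.
Qed.

Section invariance.
Context {R : realType} {n : nat} (p q : R).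
Hypotheses (n0 : (0 < n)%N) (p0 : 0 < p) (pq : p * q = p + n%:R * 2).
Local Notation mu := (lebesgue_rV R n).
Implicit Types (x y z : 'rV[R]_n) (u v : 'rV[R]_n -> R).

Lemma kerAM (l : R) y z : 0 < l ->
  kerA p (l *: y) (l *: z) = l `^ p * kerA p y z.
Proof.
move=> l0; rewrite /kerA.
have -> : distsq (l *: y) (l *: z) = l ^+ 2 * distsq y z.
  by rewrite /distsq !dotvE; ring.
by rewrite powRM ?distsq_ge0 ?sqr_ge0// sqr_powR_half// ltW.
Qed.

Lemma riesz_shift u v b : measurable_fun setT v -> riesz p q u v ->
  riesz p q (fun x => u (x + b)) (fun x => v (x + b)).
Proof.
move=> mv uv y; rewrite uv -[LHS](ge0_integral_rV_shift b)//.
- apply: eq_integral => z _; congr (_ * _)%:E.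
  rewrite /kerA !distsqE (_ : z + b - (y + b) = z - y)//.
  by rewrite opprD addrACA subrr addr0.
- by apply: measurable_kerv => //; exact: measurable_kerA.
- by move=> z; rewrite lee_fin mulr_ge0// powR_ge0.
Qed.

Lemma riesz_dilation u v (l : R) : 0 < l -> (forall x, 0 <= v x) ->
  measurable_fun setT v -> riesz p q u v ->
  riesz p q (fun x => l `^ (- (p / 2)) * u (l *: x))
            (fun x => l `^ (- (p / 2)) * v (l *: x)).
Proof.
move=> l0 v0 mv uv y; rewrite EFinM uv -[in LHS](ge0_integral_rV_dilation l0)//.
- have mvl : measurable_fun setT (fun z : 'rV[R]_n => v (l *: z)).
    exact: (measurableT_comp mv (@measurable_rV_dilation R n l)).
  rewrite muleA -EFinM -ge0_integralZl//.
  + apply: eq_integral => z _; rewrite -EFinM kerAM//; congr EFin.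
    (* The exponent [- p / 2] is chosen for this balance: [p q / 2 = - p / 2 + n + p], with [n] from
       the Jacobian and [p] from the kernel. *)
    have E : (l `^ (- (p / 2))) `^ (- q) = l `^ (- (p / 2)) * l ^+ n * l `^ p.
      rewrite -[LHS]powRrM -(powR_mulrn _ (ltW l0)).
      rewrite -!powRD ?(gt_eqF l0) ?implybT//; congr (_ `^ _).
      by move: pq; lra.
    by rewrite powRM ?powR_ge0// E; ring.
  + apply: measurable_kerv => //.
    exact: (measurableT_comp (measurable_kerA p _)
      (@measurable_rV_dilation R n l)).
  + by move=> z _; rewrite lee_fin mulr_ge0// powR_ge0.
  + by rewrite lee_fin mulr_ge0 ?powR_ge0// exprn_ge0// ltW.
- by apply: measurable_kerv => //; exact: measurable_kerA.
- by move=> z; rewrite lee_fin mulr_ge0// powR_ge0.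
Qed.

End invariance.

(** * The Kelvin transform of a solution: finiteness, positivity, continuity *)

Section kelvin_transform.
Context {R : realType} {n : nat} (p q : R).
Hypotheses (n0 : (0 < n)%N) (p0 : 0 < p) (pq : p * q = p + n%:R * 2).
Local Notation mu := (lebesgue_rV R n).
Implicit Types (x y z : 'rV[R]_n).
Variables u v : 'rV[R]_n -> R.
Hypotheses (u0 : forall x, 0 < u x) (v0 : forall x, 0 < v x).
Hypotheses (cu : continuous u) (mv : measurable_fun setT v).
Hypothesis uv : riesz p q u v.

Let int (k : 'rV[R]_n -> R) := (\int[mu]_z (k z * v z `^ (- q))%:E)%E.

Let int_ge0 (k : 'rV[R]_n -> R) : (forall z, 0 <= k z) -> (0 <= int k)%E.
Proof.
by move=> k0; apply: integral_ge0 => z _; rewrite lee_fin mulr_ge0// powR_ge0.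
Qed.

Let le_int (k k' : 'rV[R]_n -> R) :
  measurable_fun setT k -> measurable_fun setT k' ->
  (forall z, 0 <= k z) -> (forall z, k z <= k' z) -> (int k <= int k')%E.
Proof.
move=> mk mk' k0 kk'; apply: ge0_le_integral => //.
- by move=> z _; rewrite lee_fin mulr_ge0// powR_ge0.
- exact: measurable_kerv.
- exact: measurable_kerv.
- by move=> z _; rewrite lee_fin ler_wpM2r// powR_ge0.
Qed.

Let intD (k k' : 'rV[R]_n -> R) :
  measurable_fun setT k -> measurable_fun setT k' ->
  (forall z, 0 <= k z) -> (forall z, 0 <= k' z) ->
  (int (fun z => (k z + k' z)%R) = int k + int k')%E.
Proof.
move=> mk mk' k0 k'0; rewrite /int -ge0_integralD//.
- by apply: eq_integral => z _; rewrite mulrDl EFinD.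
- by move=> z _; rewrite lee_fin mulr_ge0// powR_ge0.
- exact: measurable_kerv.
- by move=> z _; rewrite lee_fin mulr_ge0// powR_ge0.
- exact: measurable_kerv.
Qed.

Let intZ (c : R) (k : 'rV[R]_n -> R) : measurable_fun setT k -> 0 <= c ->
  (forall z, 0 <= k z) -> (int (fun z => (c * k z)%R) = c%:E * int k)%E.
Proof.
move=> mk c0 k0; rewrite /int -ge0_integralZl//.
- by apply: eq_integral => z _; rewrite -EFinM mulrA.
- exact: measurable_kerv.
- by move=> z _; rewrite lee_fin mulr_ge0// powR_ge0.
Qed.

(** Up to a constant depending on [y], a majorant of [kerK p y]; its integrability against [v^(- q)]
    yields both the finiteness and the continuity at 0 of [ktrans]. *)
Let growth (z : 'rV[R]_n) : R := (1 + enorm z) `^ p.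

Let measurable_growth : measurable_fun setT growth.
Proof.
apply: (measurableT_comp (measurable_powR _)).
by apply: measurable_funD => //; exact: measurable_enorm.
Qed.

(* Off the ball of radius 1/2 about 0, or off the one about the unit vector [e],
   the kernel of [u 0] or of [u e] dominates [growth]. *)
Let int_growth : (int growth < +oo)%E.
Proof.
have [i _] : exists i : 'I_n, True by case: n n0 => // m _; exists ord0.
pose e : 'rV[R]_n := delta_mx ord0 i.
have e1 : enorm e = 1.
  rewrite enormE /dotv (bigD1 i)//= big1 ?addr0; last first.
    by move=> j /negbTE ji; rewrite !mxE eqxx ji mulr0.
  by rewrite !mxE !eqxx mulr1 sqrtr1.
(* If [|z| >= 1/2] then [1 + |z| <= 3 |z|]; otherwise [|z - e| > 1/2] and
   [1 + |z| < 3/2 < 3 |z - e|]. *)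
pose k z := 3 `^ p * (kerA p 0 z + kerA p e z).
have mk : measurable_fun setT (fun z => kerA p 0 z + kerA p e z).
  by apply: measurable_funD; exact: measurable_kerA.
have k0 z : 0 <= kerA p 0 z + kerA p e z by rewrite addr_ge0// kerA_ge0.
apply: (@le_lt_trans _ _ (int k)).
  apply: le_int => //.
  - exact: measurable_funM.
  - by move=> z; exact: powR_ge0.
  move=> z; rewrite /growth /k /kerA !distsqE -!enorm_powR subr0.
  have := enormD (z - e) e; rewrite subrK e1 => ze.
  have ez : 1 <= enorm z + enorm (z - e).
    have := enormD z (- (z - e)); rewrite opprB addrCA subrr addr0 e1.
    by rewrite -opprB enormN.
  have [h|h] := leP (1 / 2) (enorm z).
    apply: (@le_trans _ _ (3 `^ p * enorm z `^ p)).
      rewrite -powRM ?enorm_ge0//.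
      apply: ge0_ler_powR; rewrite ?nnegrE ?(ltW p0)//.
      + by rewrite addr_ge0// enorm_ge0.
      + by rewrite mulr_ge0// enorm_ge0.
      + lra.
    by rewrite ler_wpM2l ?powR_ge0// lerDl powR_ge0.
  apply: (@le_trans _ _ (3 `^ p * enorm (z - e) `^ p)).
    rewrite -powRM ?enorm_ge0//.
    apply: ge0_ler_powR; rewrite ?nnegrE ?(ltW p0)//.
    + by rewrite addr_ge0// enorm_ge0.
    + by rewrite mulr_ge0// enorm_ge0.
    + lra.
  by rewrite ler_wpM2l ?powR_ge0// lerDr powR_ge0.
rewrite intZ ?powR_ge0// intD//;
  try exact: measurable_kerA; try exact: kerA_ge0.
by rewrite /int -!uv -EFinD -EFinM ltry.
Qed.

(** Bounds on [kerK p y z] uniform over [|y| <= t], with [c = |z|]. The maximum keeps the base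
    nonnegative when [c] is large. *)
Let loww (t c : R) : R := (Num.max 0 (1 - t * c)) `^ p.
Let upp (t c : R) : R := (1 + t * c) `^ p.

Let kerK_bounds (t : R) y z : enorm y <= t ->
  loww t (enorm z) <= kerK p y z <= upp t (enorm z).
Proof.
move=> yt; have t0 : 0 <= t := le_trans (enorm_ge0 y) yt.
have z0 := enorm_ge0 z; have y0 := enorm_ge0 y.
have yz : enorm y * enorm z <= t * enorm z by rewrite ler_wpM2r.
have yz0 : 0 <= enorm y * enorm z by rewrite mulr_ge0.
apply/andP; split.
  rewrite /loww -sqr_powR_half ?le_max ?lexx//.
  apply: ge0_ler_powR; rewrite ?nnegrE ?sqr_ge0 ?invdistsq_ge0//.
    by rewrite divr_ge0// ltW.
  apply: le_trans (invdistsq_ge y z).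
  by case: (leP 0 (1 - t * enorm z)) => h; [nra|rewrite expr0n sqr_ge0].
rewrite /upp -sqr_powR_half; last lra.
apply: ge0_ler_powR; rewrite ?nnegrE ?sqr_ge0 ?invdistsq_ge0//.
  by rewrite divr_ge0// ltW.
by apply: le_trans (invdistsq_le y z) _; nra.
Qed.

Lemma integral_kerK_fin y :
  (\int[mu]_z (kerK p y z * v z `^ (- q))%:E)%E \is a fin_num.
Proof.
rewrite ge0_fin_numE; last exact/int_ge0/kerK_ge0.
pose c := (1 + enorm y) `^ p.
apply: (@le_lt_trans _ _ (int (fun z => c * growth z))).
  apply: le_int.
  - exact: measurable_kerK.
  - exact: measurable_funM.
  - exact: kerK_ge0.
  move=> z; have /andP[_ h] := @kerK_bounds (enorm y) y z (lexx _).
  apply: le_trans h _; rewrite /c /growth -powRM ?addr_ge0 ?enorm_ge0//.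
  have y0 := enorm_ge0 y; have z0 := enorm_ge0 z.
  apply: ge0_ler_powR; rewrite ?nnegrE ?mulr_ge0 ?addr_ge0 ?mulr_ge0//.
    exact: ltW.
  nra.
rewrite intZ ?powR_ge0//; last by move=> z; exact: powR_ge0.
by rewrite lte_mul_pinfty ?lee_fin ?powR_ge0.
Qed.

(* The Kelvin transform of [u], expressed through [v] so as to make sense at the
   origin. *)
Definition ktrans y : R := fine (\int[mu]_z (kerK p y z * v z `^ (- q))%:E)%E.

Lemma ktransE y :
  ((ktrans y)%:E = \int[mu]_z (kerK p y z * v z `^ (- q))%:E)%E.
Proof. by rewrite fineK// integral_kerK_fin. Qed.

Lemma ktrans_kelvin : kelvin p u ktrans.
Proof.
move=> y y0; apply: EFin_inj; rewrite ktransE EFinM uv.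
have yy0 := dotvv_gt0 y0.
rewrite -ge0_integralZl//.
- apply: eq_integral => z _; rewrite -EFinM mulrA; congr (_ * _)%:E.
  rewrite /kerA distsq_sinvl// -powRM ?divr_ge0 ?invdistsq_ge0 ?ltW//.
  by rewrite mulrC divfK// gt_eqF.
- by apply: measurable_kerv => //; exact: measurable_kerA.
- by move=> z _; rewrite lee_fin mulr_ge0// powR_ge0.
- by rewrite lee_fin powR_ge0.
Qed.

(** At the origin, where the Kelvin formula is silent, [kerK p 0 = 1]: a zero integral would make
    [v^(- q)] vanish almost everywhere, and then [u 0 = 0]. *)
Lemma ktrans_gt0 y : 0 < ktrans y.
Proof.
have [->|y0] := eqVneq y 0; last first.
  by rewrite ktrans_kelvin// mulr_gt0// powR_gt0// dotvv_gt0.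
rewrite lt_def fine_ge0 ?andbT; last exact/int_ge0/kerK_ge0.
apply/eqP => A0; have := u0 0; rewrite ltNge => /negP; apply.
rewrite -lee_fin uv le_eqVlt; apply/orP; left; apply/eqP.
have mKv := measurable_kerv q (measurable_kerK p 0) mv.
have := ktransE 0; rewrite A0 => /esym A0'.
have : ae_eq mu setT (fun z => (kerK p 0 z * v z `^ (- q))%:E) (cst 0%E).
  apply/ae_eq_integral_abs => //; rewrite -[RHS]A0'.
  by apply: eq_integral => z _; rewrite gee0_abs// lee_fin mulr_ge0// powR_ge0.
move=> h; transitivity (\int[mu]_(x in [set: 'rV[R]_n]) (cst 0 x))%E.
  apply: ge0_ae_eq_integral => //.
  - by apply: measurable_kerv => //; exact: measurable_kerA.
  - by move=> z _; rewrite lee_fin mulr_ge0// powR_ge0.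
  apply: filterS h => z /(_ I) [h] _; congr EFin; apply/eqP.
  move/eqP: h; rewrite mulf_eq0 => /orP[|/eqP ->]; last by rewrite mulr0.
  by rewrite /kerK /invdistsq !dot0v mulr0 subr0 mul0r addr0 powR1 oner_eq0.
by rewrite integral0.
Qed.

(** Bounds the oscillation of [kerK p y z] over [|y| <= t]. *)
Let gap (t : R) (z : 'rV[R]_n) : R := upp t (enorm z) - loww t (enorm z).

Let gap_ge0 (t : R) z : 0 <= t -> 0 <= gap t z.
Proof.
move=> t0; have z0 := enorm_ge0 z.
rewrite subr_ge0; apply: ge0_ler_powR; rewrite ?nnegrE ?(ltW p0)//.
- by rewrite le_max lexx.
- by rewrite addr_ge0// mulr_ge0.
- by rewrite ge_max; apply/andP; split; nra.
Qed.

Let measurable_gap t : measurable_fun setT (gap t).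
Proof.
apply: measurable_funB; apply: (measurableT_comp (measurable_powR _)).
  apply: measurable_funD => //; apply: measurable_funM => //.
  exact: measurable_enorm.
apply: measurable_maxr => //; apply: measurable_funB => //.
by apply: measurable_funM => //; exact: measurable_enorm.
Qed.

Let cvg_gap z : gap (harmonic k) z @[k --> \oo] --> 0.
Proof.
have cvgh : 1 + harmonic k * enorm z @[k --> \oo] --> (1 : R).
  rewrite -[X in _ --> X]addr0 -(mul0r (enorm z)).
  apply: cvgD; first exact: cvg_cst.
  by apply: cvgM; [exact: cvg_harmonic|exact: cvg_cst].
have cvgl : Num.max 0 (1 - harmonic k * enorm z) @[k --> \oo] --> (1 : R).
  have E : Num.max 0 (1 - 0 * enorm z) = 1 by rewrite mul0r subr0 max_r.
  rewrite -[X in _ --> X]E.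
  have cm : {for (0 : R), continuous
      ((fun=> 0 : R^o) \max (fun t : R => 1 - t * enorm z : R^o))}.
    apply: continuous_max; first exact: cvg_cst.
    apply: (@cvgB _ R^o _ (nbhs (0 : R))); first exact: cvg_cst.
    by apply: (@cvgM _ _ (nbhs (0 : R))); [exact: cvg_id|exact: cvg_cst].
  have cm' : Num.max 0 (1 - t * enorm z) @[t --> (0 : R)] -->
    Num.max 0 (1 - 0 * enorm z) by exact: cm.
  exact: (cvg_comp harmonic _ (@cvg_harmonic R) cm').
rewrite -[X in _ --> X](subrr (1 `^ p)).
by apply: cvgB; apply: cvg_powR.
Qed.

(** Dominated convergence with majorant [growth], available since [harmonic k <= 1]. *)
Let cvg_int_gap : int (gap (harmonic k)) @[k --> \oo] --> 0%E.
Proof.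
rewrite -[X in _ --> X](integral0 mu [set: 'rV[R]_n]).
have h1 k : 0 <= (harmonic k : R) <= 1.
  by rewrite harmonic_ge0/= invf_le1// ler1n.
apply: (@dominated_cvg _ _ _ mu _ measurableT _ _
  (fun z => (growth z * v z `^ (- q))%:E)) => //.
- by move=> k; exact: measurable_kerv.
- move=> z _; apply: cvg_EFin; first exact: nearW.
  rewrite -[X in _ --> X](mul0r (v z `^ (- q))).
  by apply: cvgM; [exact: cvg_gap|exact: cvg_cst].
- apply/integrableP; split; first exact: measurable_kerv.
  apply: le_lt_trans int_growth; rewrite le_eqVlt; apply/orP; left; apply/eqP.
  by apply: eq_integral => z _; rewrite gee0_abs// lee_fin mulr_ge0// powR_ge0.
- move=> k z _; have /andP[k0 k1] := h1 k.
  rewrite gee0_abs ?lee_fin ?mulr_ge0 ?gap_ge0 ?powR_ge0//.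
  rewrite ler_wpM2r ?powR_ge0// /gap /growth lerBlDr.
  apply: (@le_trans _ _ ((1 + enorm z) `^ p)); last by rewrite lerDl powR_ge0.
  have z0 := enorm_ge0 z.
  apply: ge0_ler_powR; rewrite ?nnegrE ?addr_ge0 ?mulr_ge0 ?(ltW p0)//.
  by rewrite lerD2l; rewrite ler_piMl.
Qed.

(** Off the origin the Kelvin formula is continuous. At the origin, for [|x| <= harmonic k] the
    kernels of [x] and of 0 both lie between [loww] and [upp], so the two values differ by at most
    the integral of [gap]. *)
Let cvg_ktrans y : ktrans x @[x --> y] --> ktrans y.
Proof.
have [->|y0] := eqVneq y 0; last first.
  have cvgk : dotv x x `^ (p / 2) * u (sinv x) @[x --> y] --> ktrans y.
    have cs : sinv x @[x --> y] --> sinv y.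
      by apply: (@cvg_sinv R n _ (nbhs y) _ id) => //; exact: cvg_id.
    have cus : u (sinv x) @[x --> y] --> u (sinv y).
      exact: (cvg_comp _ _ cs (@cu (sinv y))).
    have cd : dotv x x `^ (p / 2) @[x --> y] --> dotv y y `^ (p / 2).
      exact: (@cvg_powR R _ (nbhs y) _ (fun x => dotv x x) _ (p / 2)
        (dotvv_gt0 y0) (@continuous_dotvv R n y)).
    by rewrite ktrans_kelvin//; exact: (cvgM cd cus).
  apply: cvg_trans cvgk; apply: (@near_eq_cvg _ _ (nbhs y)); near=> x.
  rewrite ktrans_kelvin//; near: x.
  exact: (@cvgr_neq0 _ _ _ (nbhs y) _ id y cvg_id y0).
apply/(@cvgrPdist_le _ _ _ _ (nbhs_filter (0 : 'rV[R]_n))) => e e0.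
have /fine_cvgP[fk /cvgrPdist_le/(_ _ e0) [N _ NP]] := cvg_int_gap.
have [M _ MP] := fk.
pose k := maxn N M.
have fink : int (gap (harmonic k)) \is a fin_num by apply: MP; exact: leq_maxr.
have lek : fine (int (gap (harmonic k))) <= e.
  have := NP k (leq_maxl _ _); rewrite /= sub0r normrN ger0_norm//.
  apply/fine_ge0/int_ge0 => z; apply: gap_ge0; exact: harmonic_ge0.
have sq (k1 k2 : 'rV[R]_n -> R) : measurable_fun setT k1 ->
  measurable_fun setT k2 -> (forall z, 0 <= k1 z) -> (forall z, 0 <= k2 z) ->
  int k1 \is a fin_num -> int k2 \is a fin_num ->
  (forall z, k1 z <= k2 z + gap (harmonic k) z) ->
  fine (int k1) <= fine (int k2) + e.
  move=> mk1 mk2 k10 k20 f1 f2 k12.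
  have h z : 0 <= gap (harmonic k) z by apply: gap_ge0; exact: harmonic_ge0.
  apply: (@le_trans _ _ (fine (int k2) + fine (int (gap (harmonic k))))).
    rewrite -lee_fin EFinD !fineK// -intD//.
    apply: le_int => //; exact: measurable_funD.
  by rewrite lerD2l.
near=> x.
have xk : enorm x <= harmonic k.
  near: x.
  have h : enorm (0 : 'rV[R]_n) < harmonic k by rewrite enorm0 harmonic_gt0.
  exact: (@cvgr_le R _ _ (nbhs_filter (0 : 'rV[R]_n)) (@enorm R n) _
    (@continuous_enorm R n 0) _ h).
have z0k : enorm (0 : 'rV[R]_n) <= harmonic k by rewrite enorm0 harmonic_ge0.
have hx z := andP (kerK_bounds z xk).
have h0 z := andP (kerK_bounds z z0k).
rewrite ler_norml lerBlDr lerBrDr; apply/andP; split.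
  rewrite addrC lerBlDr.
  apply: sq => //; try exact: measurable_kerK; try exact: kerK_ge0;
    try exact: integral_kerK_fin.
  by move=> z; have [a1 a2] := hx z; have [b1 b2] := h0 z; rewrite /gap; lra.
rewrite addrC.
apply: sq => //; try exact: measurable_kerK; try exact: kerK_ge0;
  try exact: integral_kerK_fin.
by move=> z; have [a1 a2] := hx z; have [b1 b2] := h0 z; rewrite /gap; lra.
Unshelve. all: by end_near.
Qed.

Lemma continuous_ktrans : continuous ktrans.
Proof. exact: cvg_ktrans. Qed.

End kelvin_transform.

(** * Measure and compactness of balls *)

Section balls.
Context {R : realType} {n : nat}.
Local Notation mu := (lebesgue_rV R n).

(** [ball] is that of the sup norm, a cube of side [2 e]. *)
Lemma ball_measure (c : 'rV[R]_n) (e : R) : 0 < e ->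
  mu (ball c e) = ((2 * e) ^+ n)%:E.
Proof.
move=> e0.
pose A i : set R := `](c ord0 i - e), (c ord0 i + e)[%classic.
have mA i : measurable (A i) by exact: measurable_itv.
rewrite (_ : ball c e = [set y : 'rV[R]_n | forall i, A i (y ord0 i)]).
  rewrite (lebesgue_rV_box mA).
  rewrite (eq_bigr (fun=> (2 * e)%:E)); last first.
    move=> i _; rewrite /A [LHS]lebesgue_measure_itv/= lte_fin.
    by rewrite ifT; [rewrite -EFinB; congr EFin; lra|lra].
  have prodE m : (\prod_(i < m) (2 * e)%:E = ((2 * e) ^+ m)%:E)%E.
    by elim: m => [|m IH]; rewrite ?big_ord0// big_ord_recl IH exprS EFinM.
  exact: prodE.
apply/seteqP; split => y.
  move=> [_ cy] i; have := cy ord0 i.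
  by rewrite /A/= in_itv/= /ball/= distrC ltr_distl.
move=> Ay; split => // i j; rewrite ord1 /ball/= distrC ltr_distl.
by have := Ay j; rewrite /A/= in_itv.
Qed.

Lemma open_measure_gt0 (O : set 'rV[R]_n) x : open O -> O x -> (0 < mu O)%E.
Proof.
move=> oO Ox.
have /nbhs_ballP[e /= e0 xeO] : nbhs x O by exact: open_nbhs_nbhs.
apply: (@lt_le_trans _ _ (mu (ball x e))).
  by rewrite ball_measure// lte_fin exprn_gt0// mulr_gt0.
apply: le_measure; rewrite ?inE//; apply: open_measurable_rV => //.
exact: ball_open.
Qed.

Lemma oball_measure_lty : (mu oball < +oo)%E.
Proof.
apply: (@le_lt_trans _ _ (mu (ball (0 : 'rV[R]_n) 2))).
  apply: le_measure; rewrite ?inE//; first exact: measurable_oball.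
    by apply: open_measurable_rV; exact: ball_open.
  move=> y; rewrite /oball /= => y1; split => // i j.
  rewrite ord1 /ball/= mxE sub0r normrN.
  apply: le_lt_trans (coord_le_enorm y j) _.
  rewrite enormE (@le_lt_trans _ _ 1)// ?ltr1n// -sqrtr1 ler_wsqrtr//.
  exact: ltW.
by rewrite ball_measure// ltry.
Qed.

Lemma compact_cball (r : R) : compact [set x : 'rV[R]_n | dotv x x <= r].
Proof.
have cK := @rV_compact R n (fun=> `[(- Num.sqrt r), (Num.sqrt r)]%classic)
  (fun=> @segment_compact _ _ _).
apply: subclosed_compact cK _.
  rewrite (_ : [set _ | _] = ~` ((fun x => dotv x x) @^-1` [set t | r < t])).
    apply: open_closedC; apply: open_comp; last exact: open_gt.
    by move=> x _; exact: continuous_dotvv.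
  by apply/seteqP; split => x /=; rewrite leNgt => /negP.
move=> x /= xr i; rewrite in_itv/= -ler_norml.
by rewrite (le_trans (coord_le_enorm x i))// enormE ler_wsqrtr.
Qed.

Lemma cball_lower_bound (f : 'rV[R]_n -> R) (r : R) : continuous f ->
  (forall x, 0 < f x) ->
  exists2 c, 0 < c & forall x, dotv x x <= r -> c <= f x.
Proof.
move=> cf f0; have [r0|r0] := ltP r 0.
  by exists 1 => // x xr; have := le_lt_trans xr r0; rewrite ltNge dotvv_ge0.
have [||c _ cP] := @EVT_min_rV R n f _ _ (@compact_cball r).
- by exists 0; rewrite /= dot0v.
- exact: continuous_subspaceT.
by exists (f c) => // x xr; apply: cP; rewrite inE.
Qed.

(** The complement in [oball] of a compact ball; the sphere is left out, so the shells decrease to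
    the empty set. *)
Definition shell (k : nat) : set 'rV[R]_n :=
  [set z | 1 - k.+1%:R^-1 < dotv z z < 1].

Lemma measurable_shell k : measurable (shell k).
Proof.
rewrite (_ : shell k = setT `&`
    (fun z => dotv z z) @^-1` `](1 - k.+1%:R^-1), 1[).
  by apply: continuous_measurable_rV => //; exact: continuous_dotvv.
by rewrite setTI; apply/seteqP; split => z /=; rewrite in_itv.
Qed.

Lemma cvg_measure_shell : mu (shell k) @[k --> \oo] --> 0%E.
Proof.
rewrite -(measure0 mu) (_ : set0 = \bigcap_k shell k); last first.
  apply/esym/seteqP; split => // z zk.
  have z1 : dotv z z < 1 by have /andP[] := zk 0 I.
  have e0 : 0 < 1 - dotv z z by rewrite subr_gt0.
  have [k _ /(_ _ (leqnn k))/= ke] := near_infty_natSinv_lt (PosNum e0).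
  have := zk k I; rewrite /shell/= => /andP[+ _].
  by rewrite ltrBlDr -ltrBlDl ltNge (ltW ke).
apply: nonincreasing_cvg_mu.
- apply: le_lt_trans oball_measure_lty; apply: le_measure; rewrite ?inE.
  + exact: measurable_shell.
  + exact: measurable_oball.
  + by move=> z /andP[].
- exact: measurable_shell.
- by apply: bigcap_measurable => // k _; exact: measurable_shell.
- move=> j k jk; apply/subsetPset => z /andP[zk z1]; apply/andP; split => //.
  apply: le_lt_trans zk; rewrite lerD2l lerN2 lef_pV2 ?posrE ?ltr0n//.
  by rewrite ler_nat ltnS.
Qed.

End balls.

(** * Comparison on the unit ball *)

Lemma powRN_antimono (R : realType) (q a b : R) : 0 < q -> 0 < a -> a <= b ->
  b `^ (- q) <= a `^ (- q).
Proof.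
move=> q0 a0 ab; have b0 := lt_le_trans a0 ab.
rewrite !powRN lef_pV2 ?posrE ?powR_gt0//.
by apply: ge0_ler_powR; rewrite ?nnegrE ?(ltW q0) ?(ltW a0) ?(ltW b0).
Qed.

(** The convex function [m^(- q)] lies above its tangent at 1. *)
Lemma powRN_ge_tangent (R : realType) (q m : R) : 0 < q -> 1 <= m ->
  1 - m `^ (- q) <= q * (m - 1).
Proof.
move=> q0 m1; have m0 : 0 < m by lra.
have h1 : m - 1 > -1 by lra.
have := le_ln1Dx h1; rewrite addrC subrK => lnm.
rewrite /powR gt_eqF//; have := expR_ge1Dx (- q * ln m); nra.
Qed.

Section comparison.
Context {R : realType} {n : nat} (p q : R).
Hypotheses (n0 : (0 < n)%N) (p0 : 0 < p) (q0 : 0 < q)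
  (pq : p * q = p + n%:R * 2).
Local Notation mu := (lebesgue_rV R n).
Implicit Types (x y z : 'rV[R]_n) (E : set 'rV[R]_n).
Local Notation ktr := (@ktrans R n p q).

Let W (y : 'rV[R]_n) (f : 'rV[R]_n -> R) (z : 'rV[R]_n) : \bar R :=
  ((kerK p y z - kerA p y z) * f z `^ (- q))%:E.

Section one_sided.
Variables u v vs : 'rV[R]_n -> R.
Hypotheses (u0 : forall x, 0 < u x) (v0 : forall x, 0 < v x).
Hypotheses (vs0 : forall x, 0 < vs x).
Hypotheses (mv : measurable_fun setT v) (mvs : measurable_fun setT vs).
Hypotheses (uv : riesz p q u v) (vvs : kelvin p v vs).
Variable y : 'rV[R]_n.
Hypothesis y1 : oball y.

Let measurable_W f : measurable_fun setT f -> measurable_fun setT (W y f).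
Proof.
move=> mf; apply: measurable_kerv => //.
by apply: measurable_funB; [exact: measurable_kerK|exact: measurable_kerA].
Qed.

Let W_ge0 f z : oball z -> (0 <= W y f z)%E.
Proof.
move=> z1; rewrite lee_fin mulr_ge0 ?powR_ge0// subr_ge0.
by apply: kerA_le_kerK => //; exact: ltW.
Qed.

Let identity : ((u y)%:E + \int[mu]_(z in oball) W y v z =
  (ktr v y)%:E + \int[mu]_(z in oball) W y vs z)%E.
Proof.
rewrite (ktransE n0 p0 mv uv) uv.
by apply: kelvin_identity => //; exact: ltW.
Qed.

(** [W y v] is below the integrand of [ktr v y]. Finiteness is what allows cancellation in
    [identity]. *)
Let int_W_fin E : measurable E -> E `<=` oball ->
  (\int[mu]_(z in E) W y v z \is a fin_num)%E.
Proof.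
move=> mE EB; rewrite ge0_fin_numE; last first.
  by apply: integral_ge0 => z /EB; exact: W_ge0.
apply: (@le_lt_trans _ _ (ktr v y)%:E); last by rewrite ltry.
rewrite (ktransE n0 p0 mv uv).
have mK := measurable_kerv q (measurable_kerK p y) mv.
apply: (@le_trans _ _ (\int[mu]_(z in E) (kerK p y z * v z `^ (- q))%:E)%E).
  apply: ge0_le_integral => //.
  - by move=> z /EB; exact: W_ge0.
  - by apply: measurable_funTS; exact: measurable_W.
  - exact: measurable_funTS.
  - move=> z _; rewrite lee_fin ler_wpM2r ?powR_ge0// gerBl; exact: kerA_ge0.
apply: ge0_subset_integral => // z _.
by rewrite lee_fin mulr_ge0 ?powR_ge0.
Qed.

(** By [identity], [u y - ktr v y] is the integral of [W y vs - W y v]. Off [E] this is nonnegative,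
    as [vs <= v]; on [E], [vs^(- q) >= M^(- q) v^(- q)], so the loss is at most [1 - M^(- q)] times
    the integral of [W y v]. *)
Lemma ktrans_le_narrow (E : set 'rV[R]_n) (M e : R) :
  measurable E -> E `<=` oball -> 1 <= M ->
  (forall z, oball z -> ~ E z -> vs z <= v z) ->
  (forall z, E z -> vs z <= M * v z) ->
  (\int[mu]_(z in E) W y v z <= e%:E)%E ->
  ktr v y <= u y + (1 - M `^ (- q)) * e.
Proof.
move=> mE EB M1 outE inE inte.
have M0 : 0 < M by lra.
have mEc : measurable (oball `\` E).
  by apply: measurableD => //; exact: measurable_oball.
have mWv := measurable_W mv; have mWvs := measurable_W mvs.
have splitW f : measurable_fun setT f ->
  (\int[mu]_(z in oball) W y f z =
   \int[mu]_(z in oball `\` E) W y f z + \int[mu]_(z in E) W y f z)%E.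
  move=> mf; have UE : (oball `\` E) `|` E = oball by rewrite setUC setDUK.
  rewrite -[in LHS]UE ge0_integral_setU//.
  - by apply: measurable_funTS; exact: measurable_W.
  - by move=> z; rewrite UE; exact: W_ge0.
  - by rewrite disj_set2E setIC setDIK eqxx.
have le1 : (\int[mu]_(z in oball `\` E) W y v z <=
            \int[mu]_(z in oball `\` E) W y vs z)%E.
  apply: ge0_le_integral => //.
  - by move=> z [+ _]; exact: W_ge0.
  - exact: measurable_funTS.
  - exact: measurable_funTS.
  - move=> z [z1 nE]; rewrite lee_fin ler_wpM2l//.
      by rewrite subr_ge0; apply: kerA_le_kerK => //; exact: ltW.
    by apply: powRN_antimono => //; exact: outE.
have le2 : ((M `^ (- q))%:E * \int[mu]_(z in E) W y v z <=
            \int[mu]_(z in E) W y vs z)%E.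
  rewrite -ge0_integralZl//; last 3 first.
  - exact: measurable_funTS.
  - by move=> z /EB; exact: W_ge0.
  - by rewrite lee_fin powR_ge0.
  apply: ge0_le_integral => //.
  - by move=> z /EB z1; rewrite mule_ge0 ?lee_fin ?powR_ge0//; exact: W_ge0.
  - by apply: measurable_funTS; exact: measurable_funeM.
  - exact: measurable_funTS.
  - move=> z Ez; rewrite -EFinM lee_fin mulrCA ler_wpM2l//.
      by rewrite subr_ge0; apply: kerA_le_kerK => //; apply: ltW => //;
        exact: EB.
    rewrite -powRM ?(ltW M0) ?(ltW (v0 _))//.
    by apply: powRN_antimono => //; exact: inE.
have := identity; rewrite (splitW v mv) (splitW vs mvs).
have fE := int_W_fin mE EB.
have fEc := int_W_fin mEc (@subDsetl _ _ _).
move: le1 le2 inte; rewrite -(fineK fE) -(fineK fEc).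
move: (fine _) (fine _) => ic ie.
have vsE0 : (0 <= \int[mu]_(z in E) W y vs z)%E.
  by apply: integral_ge0 => z /EB; exact: W_ge0.
have vsEc0 : (0 <= \int[mu]_(z in oball `\` E) W y vs z)%E.
  by apply: integral_ge0 => z [+ _]; exact: W_ge0.
(* Infinite values are excluded by [identity], whose left side is finite. *)
case: (\int[mu]_(z in E) W y vs z)%E vsE0 => [a| |]//= _;
case: (\int[mu]_(z in oball `\` E) W y vs z)%E vsEc0 => [b| |]//= _.
rewrite -!EFinM !lee_fin -!EFinD => h1 h2 h3 [h4].
have M1q : M `^ (- q) <= 1.
  by have := powRN_antimono q0 ltr01 M1; rewrite powR1.
nra.
Qed.

(** By continuity [vs < v] on an open set around [z0], of positive measure; as [K > A] in the ball,
    the integrand [g] is positive there, whatever the point [y]. *)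
Lemma ktrans_lt z0 : continuous v -> continuous vs ->
  (forall z, oball z -> vs z <= v z) -> oball z0 -> vs z0 < v z0 ->
  ktr v y < u y.
Proof.
move=> cv cvs vsv z01 lt0.
pose g z : \bar R :=
  ((kerK p y z - kerA p y z) * (vs z `^ (- q) - v z `^ (- q)))%:E.
have mpow f : measurable_fun setT f ->
    measurable_fun setT (fun z : 'rV[R]_n => f z `^ (- q)).
  by move=> mf; exact: (measurableT_comp (measurable_powR _)).
have mB := @measurable_oball R n.
have mg : measurable_fun setT g.
  apply/measurable_EFinP; apply: measurable_funM.
    by apply: measurable_funB; [exact: measurable_kerK|exact: measurable_kerA].
  by apply: measurable_funB; exact: mpow.
have g0 z : oball z -> (0 <= g z)%E.
  move=> z1; rewrite lee_fin mulr_ge0 ?subr_ge0//.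
    by apply: kerA_le_kerK => //; exact: ltW.
  by apply: powRN_antimono => //; exact: vsv.
have intE : (\int[mu]_(z in oball) W y vs z =
    \int[mu]_(z in oball) W y v z + \int[mu]_(z in oball) g z)%E.
  rewrite -ge0_integralD//.
  - apply: eq_integral => z _.
    by rewrite -EFinD -mulrDr (addrC (v z `^ _)) subrK.
  - by move=> z; exact: W_ge0.
  - by apply: measurable_funTS; exact: measurable_W.
  - exact: measurable_funTS.
have : (0 < \int[mu]_(z in oball) g z)%E.
  rewrite lt_def integral_ge0// andbT; apply/eqP => ig0.
  have : ae_eq mu oball g (cst 0%E).
    apply/ae_eq_integral_abs => //; first exact: measurable_funTS.
    rewrite -[RHS]ig0; apply: eq_integral => z /set_mem z1.
    by rewrite gee0_abs// g0.
  move=> [N [mN N0 gN]].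
  pose O : set 'rV[R]_n := (fun z => dotv z z) @^-1` [set t | t < 1] `&`
    (fun z => vs z - v z) @^-1` [set t | t < 0].
  have oO : open O.
    apply: openI; apply: open_comp; try exact: open_lt.
      by move=> x _; exact: continuous_dotvv.
    by move=> x _; exact: (cvgB (cvs x) (cv x)).
  have : (0 < mu O)%E.
    apply: (@open_measure_gt0 R n O z0) => //; split => //=.
    by rewrite subr_lt0.
  rewrite ltNge => /negP; apply; rewrite -N0; apply: le_measure; rewrite ?inE//.
    exact: open_measurable_rV.
  move=> z [/= z1]; rewrite subr_lt0 => zlt; apply: gN => /= /(_ z1) [].
  apply/eqP; rewrite mulf_neq0//.
    by rewrite gt_eqF// subr_gt0; exact: kerA_lt_kerK.
  rewrite gt_eqF// subr_gt0 !powRN ltf_pV2 ?posrE ?powR_gt0//.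
  by apply: gt0_ltr_powR; rewrite ?nnegrE ?(ltW (v0 _)) ?(ltW (vs0 _)).
have := identity; rewrite intE.
rewrite -(fineK (int_W_fin mB (@subset_refl _ _))).
move: (fine _) => a; case: (\int[mu]_(z in oball) g z)%E => [b| |]//=.
by rewrite lte_fin -!EFinD => + b0 => -[]; lra.
Qed.

End one_sided.

End comparison.

(** * Comparison when violations are confined to a small set *)

Section narrow.
Context {R : realType} {n : nat} (p q : R).
Hypotheses (n0 : (0 < n)%N) (p0 : 0 < p) (q0 : 0 < q)
  (pq : p * q = p + n%:R * 2).
Local Notation mu := (lebesgue_rV R n).
Implicit Types (x y z : 'rV[R]_n) (E : set 'rV[R]_n).
Local Notation ktr := (@ktrans R n p q).

Lemma kelvin_usphere (u us : 'rV[R]_n -> R) z : kelvin p u us ->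
  dotv z z = 1 -> us z = u z.
Proof.
move=> uus z1; have z0 : z != 0 by rewrite -dotvv_eq0 z1 oner_eq0.
by rewrite uus// /sinv z1 powR1 mul1r invr1 scale1r.
Qed.

(* Let [M] be the largest ratio of a Kelvin transform to its function on the
   closed ball. If [M > 1], the comparison on [E] gives
   [M <= 1 + (1 - M ^ - q) e <= 1 + q (M - 1) e < M]. *)
Lemma narrow_comparison (u v : 'rV[R]_n -> R) (E : set 'rV[R]_n) (e : R) :
  (forall x, 0 < u x) -> (forall x, 0 < v x) ->
  continuous u -> continuous v -> riesz p q u v -> riesz p q v u ->
  measurable E -> E `<=` oball -> 0 < e -> q * e < 1 ->
  (forall z, oball z -> ~ E z -> ktr v z <= u z /\ ktr u z <= v z) ->
  (forall y, E y ->
    (\int[mu]_(z in E) ((kerK p y z - kerA p y z) * v z `^ (- q))%:E <=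
     (e * u y)%:E)%E /\
    (\int[mu]_(z in E) ((kerK p y z - kerA p y z) * u z `^ (- q))%:E <=
     (e * v y)%:E)%E) ->
  forall z, oball z -> ktr v z <= u z /\ ktr u z <= v z.
Proof.
move=> u0 v0 cu cv uv vu mE EB e0 qe outE onE.
have mu_ : measurable_fun setT u by exact: continuous_measurable_rV.
have mv : measurable_fun setT v by exact: continuous_measurable_rV.
have cus : continuous (ktr v) by exact: (continuous_ktrans n0 p0 cu mv uv).
have cvs : continuous (ktr u) by exact: (continuous_ktrans n0 p0 cv mu_ vu).
have us0 z : 0 < ktr v z by exact: (ktrans_gt0 n0 p0 u0 mv uv).
have vs0 z : 0 < ktr u z by exact: (ktrans_gt0 n0 p0 v0 mu_ vu).
have uus : kelvin p u (ktr v) by exact: (ktrans_kelvin n0 p0 mv uv).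
have vvs : kelvin p v (ktr u) by exact: (ktrans_kelvin n0 p0 mu_ vu).
have mus : measurable_fun setT (ktr v) by exact: continuous_measurable_rV.
have mvs : measurable_fun setT (ktr u) by exact: continuous_measurable_rV.
have ratio_max (f g : 'rV[R]_n -> R) : continuous f -> continuous g ->
    (forall x, 0 < g x) ->
    exists2 c, dotv c c <= 1 &
      forall z, dotv z z <= 1 -> f z / g z <= f c / g c.
  move=> cf cg g0.
  have cfg : continuous (fun z => f z / g z).
    move=> z; apply: (cvgM (cf z)); apply: (cvgV _ (cg z)).
    by rewrite gt_eqF.
  have A0 : [set x : 'rV[R]_n | dotv x x <= 1] !=set0.
    by exists 0; rewrite /= dot0v ler01.
  have [c cB cP] := EVT_max_rV A0 (@compact_cball R n 1)
    (continuous_subspaceT cfg).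
  exists c; first by move: cB; rewrite inE.
  by move=> z z1; apply: cP; rewrite inE.
have [c1 c11 m1] := ratio_max _ _ cus cu u0.
have [c2 c21 m2] := ratio_max _ _ cvs cv v0.
(* One [M] for both ratios, because the estimate for [u] uses the ratio for [v] on [E], and
   conversely. *)
pose M := Num.max (ktr v c1 / u c1) (ktr u c2 / v c2).
have M1 z : dotv z z <= 1 -> ktr v z <= M * u z.
  move=> z1; rewrite -ler_pdivrMr//; apply: le_trans (m1 _ z1) _.
  by rewrite le_max lexx.
have M2 z : dotv z z <= 1 -> ktr u z <= M * v z.
  move=> z1; rewrite -ler_pdivrMr//; apply: le_trans (m2 _ z1) _.
  by rewrite le_max lexx orbT.
have [Mle|Mgt] := leP M 1.
  move=> z /ltW z1; split.
    by apply: le_trans (M1 _ z1) _; rewrite ler_piMl// ltW.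
  by apply: le_trans (M2 _ z1) _; rewrite ler_piMl// ltW.
have tang := powRN_ge_tangent q0 (ltW Mgt).
have Mq : 0 <= 1 - M `^ (- q).
  rewrite subr_ge0; have := powRN_antimono q0 ltr01 (ltW Mgt).
  by rewrite powR1.
have improve z : dotv z z <= 1 ->
    ktr v z <= (1 + (1 - M `^ (- q)) * e) * u z /\
    ktr u z <= (1 + (1 - M `^ (- q)) * e) * v z.
  move=> z1; have uz := u0 z; have vz := v0 z.
  have pe : 0 <= (1 - M `^ (- q)) * e by rewrite mulr_ge0// ltW.
  have mono a b : 0 < b -> a <= b -> a <= (1 + (1 - M `^ (- q)) * e) * b by nra.
  (* The maxima are attained on the closed ball. On the sphere, where the comparison does not apply,
     a function equals its Kelvin transform. *)
  have [zB|zS] := ltP (dotv z z) 1; last first.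
    have zE : dotv z z = 1 by apply/eqP; rewrite eq_le z1.
    rewrite (kelvin_usphere uus zE) (kelvin_usphere vvs zE).
    by split; exact: mono.
  have [Ez|nEz] := pselect (E z); last first.
    by have [] := outE z zB nEz; split; exact: mono.
  have [i1 i2] := onE z Ez; split.
    have := @ktrans_le_narrow R n p q n0 p0 q0 pq u v (ktr u) v0 vs0 mv
      mvs uv vvs z zB E M (e * u z) mE EB (ltW Mgt).
    move=> /(_ (fun t t1 nE => (outE t t1 nE).2)
               (fun t Et => M2 t (ltW (EB t Et))) i1).
    by nra.
  have := @ktrans_le_narrow R n p q n0 p0 q0 pq v u (ktr v) u0 us0 mu_
      mus vu uus z zB E M (e * v z) mE EB (ltW Mgt).
  move=> /(_ (fun t t1 nE => (outE t t1 nE).1)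
               (fun t Et => M1 t (ltW (EB t Et))) i2).
  by nra.
have : M <= 1 + (1 - M `^ (- q)) * e.
  rewrite /M ge_max !ler_pdivrMr//.
  by rewrite (improve c1 c11).1 (improve c2 c21).2.
by move=> h; exfalso; nra.
Qed.

End narrow.

(** * The critical dilation *)

Section moving_spheres.
Context {R : realType} {n : nat} (p q : R).
Hypotheses (n0 : (0 < n)%N) (p0 : 0 < p) (q0 : 0 < q)
  (pq : p * q = p + n%:R * 2).
Local Notation mu := (lebesgue_rV R n).
Local Notation ktr := (@ktrans R n p q).

(** The dilation that preserves the system ([riesz_dilation]); it reduces inversion in the sphere of
    radius [l] to inversion in the unit sphere. *)
Definition scal (l : R) (u : 'rV[R]_n -> R) (x : 'rV[R]_n) : R :=
  l `^ (- (p / 2)) * u (l *: x).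

Lemma scal_gt0 l u x : 0 < l -> (forall x, 0 < u x) -> 0 < scal l u x.
Proof. by move=> l0 u0; rewrite mulr_gt0// powR_gt0. Qed.

Lemma continuous_scal l u : continuous u -> continuous (scal l u).
Proof.
move=> cu x.
have h : l *: y @[y --> x] --> l *: x by exact: scaler_continuous.
have hu : u (l *: y) @[y --> x] --> u (l *: x).
  exact: (cvg_comp _ _ h (cu (l *: x))).
exact: (cvgM (cvg_cst _) hu).
Qed.

(** [kerK p] is unchanged when [y] is divided by [l] and [z] multiplied by [l], so dilating the
    integration variable acts on [y] by the inverse dilation. *)
Lemma ktrans_scal l (v : 'rV[R]_n -> R) y : 0 < l ->
  measurable_fun setT v -> (forall x, 0 < v x) ->
  ktr (scal l v) y = l `^ (p / 2) * ktr v (l^-1 *: y).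
Proof.
move=> l0 mv v0.
have mK := measurable_kerv q (measurable_kerK p (l^-1 *: y)) mv.
have K0 z : (0 <= (kerK p (l^-1 *: y) z * v z `^ (- q))%:E)%E.
  by rewrite lee_fin mulr_ge0 ?kerK_ge0 ?powR_ge0.
have fineZ (r : R) (a : \bar R) : 0 < r -> fine (r%:E * a)%E = r * fine a.
  case: a => [a|r0|r0]; first by rewrite -EFinM.
    by rewrite gt0_muley ?lte_fin// mulr0.
  by rewrite gt0_muleNy ?lte_fin// mulr0.
rewrite /ktrans -fineZ ?powR_gt0//; congr fine.
rewrite -[in RHS](ge0_integral_rV_dilation l0 mK K0) muleA -EFinM.
have mvl : measurable_fun setT (fun z : 'rV[R]_n => v (l *: z)).
  exact: (measurableT_comp mv (@measurable_rV_dilation R n l)).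
have KE z : kerK p (l^-1 *: y) (l *: z) = kerK p y z.
  rewrite /kerK /invdistsq !dotvE; congr (_ `^ _).
  by field; rewrite gt_eqF.
under [in RHS]eq_integral do rewrite KE.
rewrite -ge0_integralZl//.
- apply: eq_integral => z _; rewrite -EFinM; congr EFin.
  have E : (l `^ (- (p / 2))) `^ (- q) = l `^ (p / 2) * l ^+ n.
    rewrite -[LHS]powRrM -(powR_mulrn _ (ltW l0)).
    rewrite -!powRD ?(gt_eqF l0) ?implybT//; congr (_ `^ _).
    by move: pq; lra.
  by rewrite /scal powRM ?powR_ge0 ?(ltW (v0 _))// E; ring.
- by apply: measurable_kerv => //; exact: measurable_kerK.
- by move=> z _; rewrite lee_fin mulr_ge0 ?kerK_ge0 ?powR_ge0.
- by rewrite lee_fin mulr_ge0 ?powR_ge0// exprn_ge0// ltW.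
Qed.

(** [l^(p / 2)] times [scal l u y - ktr (scal l v) y] (see [scal_ktrans]), written through functions
    that do not depend on [l], so that it is jointly continuous in [l] and [y]. *)
Definition slack (u v : 'rV[R]_n -> R) (l : R) (y : 'rV[R]_n) : R :=
  u (l *: y) - l `^ p * ktr v (l^-1 *: y).

Lemma scal_ktrans (u v : 'rV[R]_n -> R) l y : 0 < l ->
  measurable_fun setT v -> (forall x, 0 < v x) ->
  scal l u y - ktr (scal l v) y = l `^ (- (p / 2)) * slack u v l y.
Proof.
move=> l0 mv v0; rewrite ktrans_scal// /scal /slack mulrBr mulrA.
congr (_ - _ * _); rewrite -powRD ?(gt_eqF l0) ?implybT//; congr (_ `^ _); lra.
Qed.

Lemma slack_ge0 (u v : 'rV[R]_n -> R) l y : 0 < l ->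
  measurable_fun setT v -> (forall x, 0 < v x) ->
  0 <= slack u v l y <-> ktr (scal l v) y <= scal l u y.
Proof.
move=> l0 mv v0; rewrite -(subr_ge0 (ktr (scal l v) y)) scal_ktrans//.
by rewrite pmulr_rge0// powR_gt0.
Qed.

Lemma slack_gt0 (u v : 'rV[R]_n -> R) l y : 0 < l ->
  measurable_fun setT v -> (forall x, 0 < v x) ->
  0 < slack u v l y <-> ktr (scal l v) y < scal l u y.
Proof.
move=> l0 mv v0; rewrite -(subr_gt0 (ktr (scal l v) y)) scal_ktrans//.
by rewrite pmulr_rgt0// powR_gt0.
Qed.

Lemma slack_cvg (u v : 'rV[R]_n -> R) T (F : set_system T) {FF : Filter F}
    (f : T -> 'rV[R]_n) (g : T -> R) (l0 : R) (y0 : 'rV[R]_n) : 0 < l0 ->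
  continuous u -> continuous (ktr v) -> f @ F --> y0 -> g @ F --> l0 ->
  slack u v (g x) (f x) @[x --> F] --> slack u v l0 y0.
Proof.
move=> l00 cu cv fy gl.
have c1 : g x *: f x @[x --> F] --> l0 *: y0 by exact: cvgZ.
have c2 : (g x)^-1 *: f x @[x --> F] --> l0^-1 *: y0.
  by apply: cvgZ => //; apply: cvgV => //; rewrite gt_eqF.
have c3 : g x `^ p @[x --> F] --> l0 `^ p by exact: cvg_powR.
have c4 := cvg_comp _ _ c1 (cu (l0 *: y0)).
have c5 := cvg_comp _ _ c2 (cv (l0^-1 *: y0)).
exact: (cvgB c4 (cvgM c3 c5)).
Qed.

Section pair.
Variables u v : 'rV[R]_n -> R.
Hypotheses (u0 : forall x, 0 < u x) (v0 : forall x, 0 < v x).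
Hypotheses (cu : continuous u) (cv : continuous v).
Hypotheses (uv : riesz p q u v) (vu : riesz p q v u).

Let mu_ : measurable_fun setT u. Proof. exact: continuous_measurable_rV. Qed.
Let mv : measurable_fun setT v. Proof. exact: continuous_measurable_rV. Qed.

Let scal_riesz (l : R) : 0 < l -> riesz p q (scal l u) (scal l v).
Proof. by move=> l0; apply: riesz_dilation => // x; exact: ltW. Qed.

Let scal_riesz' (l : R) : 0 < l -> riesz p q (scal l v) (scal l u).
Proof. by move=> l0; apply: riesz_dilation => // x; exact: ltW. Qed.

(** The equation for [u] sees [v] through an integral over the whole ball, so strictness for [v] at
    one point is felt by [u] at every point. *)
Lemma slack_strict (l : R) z0 y : 0 < l ->
  (forall z, oball z -> 0 <= slack v u l z) -> oball z0 -> oball y ->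
  0 < slack v u l z0 -> 0 < slack u v l y.
Proof.
move=> l0 dl z01 y1 /(slack_gt0 v z0 l0 mu_ u0) lt0.
apply/(slack_gt0 u y l0 mv v0).
have cul : continuous (scal l u) by exact: continuous_scal.
have cvl : continuous (scal l v) by exact: continuous_scal.
have mul : measurable_fun setT (scal l u) by exact: continuous_measurable_rV.
have mvl : measurable_fun setT (scal l v) by exact: continuous_measurable_rV.
have u0l x : 0 < scal l u x by exact: scal_gt0.
have v0l x : 0 < scal l v x by exact: scal_gt0.
have ck : continuous (ktr (scal l u)).
  exact: (continuous_ktrans n0 p0 cvl mul (scal_riesz' l0)).
have mk : measurable_fun setT (ktr (scal l u)).
  exact: continuous_measurable_rV.
have k0 x : 0 < ktr (scal l u) x.
  exact: (ktrans_gt0 n0 p0 v0l mul (scal_riesz' l0)).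
have kk : kelvin p (scal l v) (ktr (scal l u)).
  exact: (ktrans_kelvin n0 p0 mul (scal_riesz' l0)).
apply: (ktrans_lt n0 p0 q0 pq v0l k0 mvl mk (scal_riesz l0) kk y1 cvl ck)
  z01 lt0.
by move=> z z1; apply/(slack_ge0 v z l0 mu_ u0); exact: dl.
Qed.

End pair.

(** * Dominated radii: existence, boundedness, continuation *)

Section critical.
Variables u v : 'rV[R]_n -> R.
Hypotheses (u0 : forall x, 0 < u x) (v0 : forall x, 0 < v x).
Hypotheses (cu : continuous u) (cv : continuous v).
Hypotheses (uv : riesz p q u v) (vu : riesz p q v u).

Let mu_ : measurable_fun setT u. Proof. exact: continuous_measurable_rV. Qed.
Let mv : measurable_fun setT v. Proof. exact: continuous_measurable_rV. Qed.

Let cktru : continuous (ktr u).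
Proof. exact: (continuous_ktrans n0 p0 cv mu_ vu). Qed.

Let cktrv : continuous (ktr v).
Proof. exact: (continuous_ktrans n0 p0 cu mv uv). Qed.

Let scal_riesz (l : R) : 0 < l -> riesz p q (scal l u) (scal l v).
Proof. by move=> l0; apply: riesz_dilation => // x; exact: ltW. Qed.

Let scal_riesz' (l : R) : 0 < l -> riesz p q (scal l v) (scal l u).
Proof. by move=> l0; apply: riesz_dilation => // x; exact: ltW. Qed.

Definition dominated (l : R) := forall y, oball y ->
  0 <= slack u v l y /\ 0 <= slack v u l y.

(** Bounds [kerK] on the ball, where [invdistsq y z <= (1 + |y| |z|)^2 <= 4]. *)
Let kap : R := 4 `^ (p / 2).

Let narrow_int (f : 'rV[R]_n -> R) (c : R) (E : set 'rV[R]_n) y :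
  measurable_fun setT f -> 0 < c -> measurable E -> E `<=` oball -> oball y ->
  (forall z, oball z -> c <= f z) ->
  (\int[mu]_(z in E) ((kerK p y z - kerA p y z) * f z `^ (- q))%:E <=
   (kap * c `^ (- q))%:E * mu E)%E.
Proof.
move=> mf c0 mE EB y1 cf.
apply: (@le_trans _ _ (\int[mu]_(z in E) (kap * c `^ (- q))%:E)%E); last first.
  by rewrite integral_cst.
apply: ge0_le_integral => //.
- move=> z /EB z1; rewrite lee_fin mulr_ge0 ?powR_ge0// subr_ge0.
  by apply: kerA_le_kerK => //; exact: ltW.
- apply: measurable_funTS; apply: measurable_kerv => //.
  by apply: measurable_funB; [exact: measurable_kerK|exact: measurable_kerA].
move=> z /EB z1; rewrite lee_fin ler_pM ?powR_ge0 ?subr_ge0//.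
- by apply: kerA_le_kerK => //; exact: ltW.
- apply: (@le_trans _ _ (kerK p y z)); first by rewrite gerBl kerA_ge0.
  apply: ge0_ler_powR; rewrite ?nnegrE ?invdistsq_ge0//.
    by rewrite divr_ge0// ltW.
  apply: le_trans (invdistsq_le y z) _.
  have le1 (x : 'rV[R]_n) : oball x -> enorm x <= 1.
    by move=> x1; rewrite enormE -sqrtr1 ler_wsqrtr// ltW.
  have : 0 <= enorm y * enorm z by rewrite mulr_ge0 ?enorm_ge0.
  have : enorm y * enorm z <= 1 by rewrite mulr_ile1 ?enorm_ge0 ?le1.
  by move: (enorm y * enorm z) => t; nra.
- by apply: powRN_antimono => //; exact: cf.
Qed.

(** [narrow_comparison] with [e = (2 q)^-1], so that [q e = 1/2]. The smallness of [E] is uniform in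
    [y]: the integrals over [E] are at most [kap * c^(- q) * mu E], to be compared with [e] times
    the lower bound [c]. *)
Lemma narrow_dominated (l c : R) (E : set 'rV[R]_n) : 0 < l -> 0 < c ->
  measurable E -> E `<=` oball ->
  (forall z, oball z -> c <= scal l u z /\ c <= scal l v z) ->
  ((kap * c `^ (- q))%:E * mu E <= ((2 * q)^-1 * c)%:E)%E ->
  (forall y, oball y -> ~ E y -> 0 <= slack u v l y /\ 0 <= slack v u l y) ->
  dominated l.
Proof.
move=> l0 c0 mE EB cB muE outE.
have cul : continuous (scal l u) by exact: continuous_scal.
have cvl : continuous (scal l v) by exact: continuous_scal.
have mul : measurable_fun setT (scal l u) by exact: continuous_measurable_rV.
have mvl : measurable_fun setT (scal l v) by exact: continuous_measurable_rV.
move=> z z1.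
suff [h1 h2] : ktr (scal l v) z <= scal l u z /\ ktr (scal l u) z <= scal l v z.
  split; first exact/(slack_ge0 u z l0 mv v0).
  exact/(slack_ge0 v z l0 mu_ u0).
move: z z1.
apply: (@narrow_comparison R n p q n0 p0 q0 pq (scal l u) (scal l v) E
  (2 * q)^-1 (fun x => scal_gt0 x l0 u0) (fun x => scal_gt0 x l0 v0)
  cul cvl (scal_riesz l0) (scal_riesz' l0) mE EB) => //.
- by rewrite invr_gt0 mulr_gt0.
- have -> : q * (2 * q)^-1 = 2^-1 by field; rewrite gt_eqF.
  by rewrite invf_lt1// ltr1n.
- move=> y y1 nE.
  have [/(slack_ge0 u y l0 mv v0) h1 /(slack_ge0 v y l0 mu_ u0) h2] :=
    outE y y1 nE.
  by split.
move=> y /EB y1; have [c1 c2] := cB y y1.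
have iq : 0 < (2 * q)^-1 by rewrite invr_gt0 mulr_gt0.
split.
  apply: le_trans (narrow_int mvl c0 mE EB y1 (fun z z1 => (cB z z1).2)) _.
  by apply: le_trans muE _; rewrite lee_fin ler_wpM2l// ltW.
apply: le_trans (narrow_int mul c0 mE EB y1 (fun z z1 => (cB z z1).1)) _.
by apply: le_trans muE _; rewrite lee_fin ler_wpM2l// ltW.
Qed.

(** Here [E] is the whole ball. With [s = l^(p / 2)] the rescaled functions are at least [s^-1 c] on
    it; as [s] decreases this bound grows while its power [- q] decreases, so the smallness
    condition is met. *)
Lemma exists_dominated : exists2 l, 0 < l & dominated l.
Proof.
have [cu0 cu00 cuP] := cball_lower_bound 1 cu u0.
have [cv0 cv00 cvP] := cball_lower_bound 1 cv v0.
pose c := Num.min cu0 cv0.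
have c0 : 0 < c by rewrite lt_min cu00.
have mB : mu oball \is a fin_num.
  by rewrite ge0_fin_numE ?measure_ge0 ?oball_measure_lty.
pose m := fine (mu oball).
have m0 : 0 <= m by rewrite fine_ge0.
pose a := (2 * q)^-1 * c.
(* The [+ 1] makes [b] positive whatever [m >= 0] is. *)
pose b := kap * c `^ (- q) * m + 1.
have a0 : 0 < a by rewrite mulr_gt0// invr_gt0 mulr_gt0.
have b0 : 0 < b by rewrite ltr_wpDl// !mulr_ge0 ?powR_ge0.
pose s := Num.min 1 (a / b).
have s0 : 0 < s by rewrite lt_min ltr01 divr_gt0.
have s1 : s <= 1 by rewrite ge_min lexx.
have sab : s * b <= a by rewrite -ler_pdivlMr// ge_min lexx orbT.
pose l := s `^ (2 / p).
have l0 : 0 < l by exact: powR_gt0.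
have l1 : l <= 1.
  apply: (@le_trans _ _ (1 `^ (2 / p))); last by rewrite powR1.
  apply: ge0_ler_powR; rewrite ?nnegrE ?(ltW s0)//.
  by rewrite divr_ge0// ltW.
have lp : l `^ (p / 2) = s.
  rewrite -[LHS]powRrM (_ : _ * _ = 1) ?powRr1 ?ltW//.
  by field; rewrite gt_eqF.
have lpN : l `^ (- (p / 2)) = s^-1 by rewrite powRN lp.
have scal_ge (f : 'rV[R]_n -> R) z : oball z ->
    (forall x, dotv x x <= 1 -> c <= f x) -> s^-1 * c <= scal l f z.
  move=> z1 cf; rewrite /scal lpN ler_wpM2l ?invr_ge0 ?(ltW s0)//.
  apply: cf; rewrite !dotvE mulrA -expr2.
  by rewrite mulr_ile1 ?sqr_ge0 ?dotvv_ge0 ?(ltW z1)// expr_le1// ltW.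
exists l; first exact: l0.
have s1c : 0 < s^-1 * c by rewrite mulr_gt0// invr_gt0.
apply: (@narrow_dominated l (s^-1 * c) oball) => //.
- exact: measurable_oball.
- move=> z z1; split; apply: scal_ge => // x x1.
    by apply: le_trans (cuP x x1); rewrite ge_min lexx.
  by apply: le_trans (cvP x x1); rewrite ge_min lexx orbT.
rewrite -(fineK mB) -/m -EFinM lee_fin.
have -> : (2 * q)^-1 * (s^-1 * c) = s^-1 * a by rewrite /a; ring.
rewrite -ler_pdivrMl ?invr_gt0// invrK; apply: le_trans sab.
rewrite ler_wpM2l ?(ltW s0)//.
apply: (@le_trans _ _ (kap * c `^ (- q) * m)); last by rewrite lerDl.
rewrite ler_wpM2r// ler_wpM2l ?powR_ge0//.
apply: powRN_antimono => //; rewrite ler_peMl ?(ltW c0)//.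
by rewrite invf_ge1.
Qed.

(** At [y = 0] domination reads [l^p * ktr v 0 <= u 0]. *)
Lemma dominated_bound (l : R) : 0 < l -> dominated l ->
  l <= (u 0 / ktr v 0) `^ p^-1.
Proof.
move=> l0 /(_ 0); rewrite /oball /= dot0v => /(_ ltr01)[+ _].
rewrite /slack !scaler0 subr_ge0 => h.
have A0 : 0 < ktr v 0 by exact: (ktrans_gt0 n0 p0 u0 mv uv).
have -> : l = (l `^ p) `^ p^-1.
  by rewrite -powRrM divff ?gt_eqF// powRr1// ltW.
apply: ge0_ler_powR; rewrite ?nnegrE ?powR_ge0 ?invr_ge0 ?(ltW p0)//.
  by rewrite divr_ge0// ltW.
by rewrite (ler_pdivlMr _ _ A0).
Qed.

(** The slack vanishes on the sphere, so its positivity inside is not uniform. Compactness handles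
    the complement of a shell, and [narrow_dominated] the shell. *)
Lemma dominated_open (l0 : R) : 0 < l0 ->
  (forall y, oball y -> 0 < slack u v l0 y /\ 0 < slack v u l0 y) ->
  exists2 l, l0 < l & dominated l.
Proof.
move=> l00 pos.
have [cu0 cu00 cuP] := cball_lower_bound ((2 * l0) ^+ 2) cu u0.
have [cv0 cv00 cvP] := cball_lower_bound ((2 * l0) ^+ 2) cv v0.
have l20 : 0 < 2 * l0 by rewrite mulr_gt0.
(* A lower bound valid for all [l <= 2 * l0]: it determines the shell, and [l] is chosen only after
   the shell. *)
pose c := (2 * l0) `^ (- (p / 2)) * Num.min cu0 cv0.
have c0 : 0 < c by rewrite mulr_gt0 ?powR_gt0// lt_min cu00.
have scal_ge l (f : 'rV[R]_n -> R) z : 0 < l -> l <= 2 * l0 -> oball z ->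
    (forall x, dotv x x <= (2 * l0) ^+ 2 -> Num.min cu0 cv0 <= f x) ->
    c <= scal l f z.
  move=> lp ll z1 cf; rewrite /scal ler_pM ?powR_ge0 ?le_min//.
  - by rewrite (ltW cu00) (ltW cv00).
    by apply: powRN_antimono => //; rewrite divr_gt0.
  apply: cf; rewrite !dotvE mulrA -expr2.
  rewrite -[leRHS]mulr1 ler_pM ?sqr_ge0 ?dotvv_ge0 ?(ltW z1)//.
  by rewrite ler_sqr ?nnegrE ?(ltW lp) ?(ltW l20).
have [k muk] : exists k,
    ((kap * c `^ (- q))%:E * mu (shell k) <= ((2 * q)^-1 * c)%:E)%E.
  have a0 : 0 < (2 * q)^-1 * c by rewrite mulr_gt0// invr_gt0 mulr_gt0.
  have b0 : 0 < kap * c `^ (- q) by rewrite mulr_gt0 ?powR_gt0.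
  have ab0 : 0 < (2 * q)^-1 * c / (kap * c `^ (- q)) by rewrite divr_gt0.
  have /fine_cvgP[[N _ NP] /cvgrPdist_le/(_ _ ab0) [M _ MP]] :=
    @cvg_measure_shell R n.
  exists (maxn N M).
  have fk : mu (shell (maxn N M)) \is a fin_num by apply: NP; exact: leq_maxl.
  have := MP _ (leq_maxr N M).
  rewrite /= sub0r normrN ger0_norm ?fine_ge0// => h.
  by rewrite -(fineK fk) -EFinM lee_fin mulrC -ler_pdivlMr.
pose P (l : R) (y : 'rV[R]_n) : Prop := 0 < slack u v l y /\ 0 < slack v u l y.
have nearP : \forall l \near l0,
    [set y : 'rV[R]_n | dotv y y <= 1 - k.+1%:R^-1] `<=` P l.
  (* Tube lemma: positivity is open in [(y, l)], so over a compact set of [y] one neighbourhood of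
     [l0] serves for all. *)
  have NC := (compact_near_coveringP _).1
    (@compact_cball R n (1 - k.+1%:R^-1)).
  apply: (NC _ (nbhs l0) P (nbhs_filter l0)) => y yr.
  have y1 : oball y by apply: le_lt_trans yr _; rewrite ltrBlDr ltrDl invr_gt0.
  have [p1 p2] := pos y y1.
  have FF : Filter (filter_prod (nbhs y) (nbhs l0)).
    by apply: filter_prod_filter; exact: nbhs_filter.
  have s1 := @slack_cvg u v _ (filter_prod (nbhs y) (nbhs l0)) FF fst snd l0 y
    l00 cu cktrv cvg_fst cvg_snd.
  have s2 := @slack_cvg v u _ (filter_prod (nbhs y) (nbhs l0)) FF fst snd l0 y
    l00 cv cktru cvg_fst cvg_snd.
  have h1 := @cvgr_gt _ _ _ FF _ _ (s1 (nbhs_filter l0) (nbhs_filter y)) _ p1.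
  have h2 := @cvgr_gt _ _ _ FF _ _ (s2 (nbhs_filter l0) (nbhs_filter y)) _ p2.
  have h := @filterI _ _ FF _ _ h1 h2.
  exact: (@filterS _ (filter_prod (nbhs y) (nbhs l0)) FF _ _ _ h).
have nearr : \forall l \near l0^'+,
    [/\ l0 < l, l <= 2 * l0 &
    [set y : 'rV[R]_n | dotv y y <= 1 - k.+1%:R^-1] `<=` P l].
  near=> l; split; near: l.
  - exact: nbhs_right_gt.
  - by apply: nbhs_right_le; lra.
  - exact: cvg_at_right_filter cvg_id _ nearP.
have [l [ll l2 lP]] := filter_ex nearr.
exists l; first exact: ll.
have lp := lt_trans l00 ll.
apply: (@narrow_dominated l c (shell k) lp c0 _ _ _ muk).
- exact: measurable_shell.
- by move=> z /andP[].
- move=> z z1; split; apply: scal_ge => // x x1.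
    by apply: le_trans (cuP x x1); rewrite ge_min lexx.
  by apply: le_trans (cvP x x1); rewrite ge_min lexx orbT.
move=> y y1 /negP; rewrite negb_and -!leNgt => /orP[yk|]; last first.
  by rewrite leNgt => /negP.
by have [/ltW ? /ltW ?] := lP y yk.
Unshelve. all: by end_near.
Qed.

Theorem critical_dilation : exists2 l, 0 < l &
  forall y, oball y -> slack u v l y = 0 /\ slack v u l y = 0.
Proof.
have [l1 l10 d1] := exists_dominated.
pose S : set R := [set l | 0 < l /\ dominated l].
have S1 : S l1 by [].
have supS : has_sup S.
  split; first by exists l1.
  by exists ((u 0 / ktr v 0) `^ p^-1) => l [l0 dl]; exact: dominated_bound.
pose l := sup S.
have l1l : l1 <= l by apply: sup_upper_bound.
have l0 : 0 < l by exact: lt_le_trans l1l.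
(* A negative slack at the supremum would persist at some nearby element of [S]. *)
have closed_slack (f g : 'rV[R]_n -> R) y :
    continuous f -> continuous (ktr g) ->
    (forall t, S t -> 0 <= slack f g t y) -> 0 <= slack f g l y.
  move=> cf cg fS; rewrite leNgt; apply/negP => neg.
  have c := @slack_cvg f g _ (nbhs l) (nbhs_filter l) (fun=> y) id l y l0 cf cg
    (cvg_cst _) cvg_id.
  have h : \forall t \near l, slack f g t y < 0.
    exact: (@cvgr_lt _ _ _ (nbhs_filter l) _ _ (c (nbhs_filter l)) _ neg).
  have [e /= e0 eP] := (nbhs_ballP _ _).1 h.
  have [t St tl] := sup_adherent e0 supS.
  have tl' : t <= l by apply: sup_upper_bound.
  have : slack f g t y < 0.
    apply: eP; rewrite /ball/= ger0_norm ?subr_ge0//.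
    by rewrite ltrBlDr addrC -ltrBlDr.
  by rewrite ltNge fS.
have dl : dominated l.
  move=> y y1; split; apply: closed_slack => // t [t0 dt].
    by have [] := dt y y1.
  by have [] := dt y y1.
exists l; first exact: l0.
apply: contrapT => /existsNP[y] /not_implyP[y1].
have lt_dual z0 z : oball z0 -> oball z ->
    0 < slack u v l z0 -> 0 < slack v u l z.
  move=> z01 z1; apply: (slack_strict v0 u0 cv cu vu uv l0 _ z01 z1).
  by move=> x x1; have [] := dl x x1.
have lt_prim z0 z : oball z0 -> oball z ->
    0 < slack v u l z0 -> 0 < slack u v l z.
  move=> z01 z1; apply: (slack_strict u0 v0 cu cv uv vu l0 _ z01 z1).
  by move=> x x1; have [] := dl x x1.
move=> /not_andP neq.
(* Strictness for one function gives it for the other on the whole ball, and coming back gives it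
   everywhere for the first. *)
have pos : forall z, oball z -> 0 < slack u v l z /\ 0 < slack v u l z.
  have [s1 s2] := dl y y1.
  case: neq => /eqP neq z z1.
    have h1 : 0 < slack u v l y by rewrite lt_def neq s1.
    have h2 := lt_dual _ _ y1 z1 h1; split; last exact: h2.
    exact: (lt_prim z z z1 z1 h2).
  have h1 : 0 < slack v u l y by rewrite lt_def neq s2.
  have h2 : 0 < slack u v l z by exact: (lt_prim y z y1 z1 h1).
  by split; [exact: h2|exact: (lt_dual z z z1 z1 h2)].
have [l' ll' dl'] := dominated_open l0 pos.
have l'0 : 0 < l' := lt_trans l0 ll'.
have : l' <= l by apply: (sup_upper_bound supS); split; [exact: l'0|exact: dl'].
by rewrite leNgt ll'.
Qed.

End critical.

End moving_spheres.

(** * Rigidity of the inversion identity *)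

(** The hypothesis is covariance under the inversion about each [s] with squared radius [f s]. It
    forces [f' s = f' 0 + 2 s], hence the quadratic. The linear coefficient is expressed by values
    of [f], which suits the differences [b] in [inversive_rigidity]. *)
Lemma inversive_monic_quadratic (R : realType) (f : R -> R) :
  (forall t, 0 < f t) -> (forall t, derivable f t (1 : R)) ->
  (forall s h : R, h != 0 -> h ^+ 2 < f s ->
    f (s + h) = h ^+ 2 / f s * f (s + f s / h)) ->
  forall t, f t = t ^+ 2 + t * (f 1 - f 0 - 1) + f 0.
Proof.
move=> f0 df fe.
have dfP (t : R) : is_derive t (1 : R) f ('D_1 f t) by exact: derivableP.
have key (s : R) : 'D_1 f s = 'D_1 f 0 + 2 * s.
  (* Composing the reflections about [s] and about [0], both of which pass
     through the point [s + f s / h], relates [f] near [s] to [f] near [0]. *)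
  pose k h := f 0 * h * (s * h + f s)^-1.
  (* As [f 0 / k h = s + f s / h], the identities about [s] and about 0 share a value of [f].
     Eliminating it and clearing denominators gives [G1 = G2], which makes sense at [h = 0] and can
     be differentiated there. *)
  pose G1 (h : R) : R := f s * f 0 * f (s + h).
  pose G2 (h : R) : R := f (k h) * (s * h + f s) ^+ 2.
  have fs0 := f0 s; have f00 := f0 0.
  have cd : continuous (fun h : R => s * h + f s).
    move=> h; apply: cvgD; last exact: cvg_cst.
    by apply: cvgM; [exact: cvg_cst|exact: cvg_id].
  have ck : k h @[h --> (0 : R)] --> (0 : R).
    rewrite -[X in _ --> X](_ : k 0 = 0); last by rewrite /k mulr0 mul0r.
    apply: cvgM; first by apply: cvgM; [exact: cvg_cst|exact: cvg_id].
    by apply: cvgV; [rewrite mulr0 add0r gt_eqF|exact: cd].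
  have G12 : \forall h \near (0 : R), G1 h = G2 h.
    near=> h.
    have [->|h0] := eqVneq h 0.
      by rewrite /G1 /G2 /k !mulr0 mul0r addr0 add0r; ring.
    have d0 : 0 < s * h + f s.
      near: h; apply: (cvgr_gt _ (cd (0 : R))).
      by rewrite mulr0 add0r.
    have hs : h ^+ 2 < f s.
      near: h; apply: (cvgr_lt _ (@exprn_continuous R 2 (0 : R))).
      by rewrite expr0n.
    have ks : k h ^+ 2 < f 0.
      near: h.
      have c2 : (k h) ^+ 2 @[h --> (0 : R)] --> (0 : R) ^+ 2.
        exact: (cvg_comp _ _ ck (@exprn_continuous R 2 (0 : R))).
      by apply: (cvgr_lt _ c2); rewrite expr0n.
    have k0 : k h != 0.
      by rewrite /k !mulf_neq0 ?invr_neq0// gt_eqF.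
    have e1 := fe s h h0 hs.
    have e2 := fe 0 (k h) k0 ks.
    rewrite add0r in e2.
    have tE : 0 + f 0 / k h = s + f s / h.
      by rewrite /k; field; rewrite h0 !gt_eqF.
    rewrite tE in e2; rewrite /G1 /G2 e1 e2 /k; field.
    by rewrite !gt_eqF.
  have dk : is_derive (0 : R) (1 : R) k (f 0 / f s).
    have d1 : is_derive (0 : R) (1 : R) (fun h : R => s * h + f s) s.
      by apply: is_derive_eq; rewrite /GRing.scale/=; ring.
    have d2 : is_derive (0 : R) (1 : R) (fun h : R => f 0 * h) (f 0).
      by apply: is_derive_eq; rewrite /GRing.scale/=; ring.
    have n0 : s * 0 + f s != 0 by rewrite mulr0 add0r gt_eqF.
    have d3 := @is_deriveV R (fun h : R => s * h + f s) 0 s 1 n0 d1.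
    apply: (@trigger_derive R k 0 _ _ (is_deriveM d2 d3)).
    by rewrite /GRing.scale/= !mulr0 mul0r !add0r mulrC.
  have dG1 : is_derive (0 : R) (1 : R) G1 (f s * f 0 * 'D_1 f s).
    have d1 : is_derive (0 : R) (1 : R) (fun h : R => s + h) 1.
      apply: (@trigger_derive R _ 0 _ _ (is_deriveD (is_derive_cst s _ _)
        (is_derive_id (0 : R) (1 : R)))).
      by rewrite add0r.
    have ds : is_derive ((fun h : R => s + h) 0) (1 : R) f ('D_1 f s).
      by rewrite addr0; exact: dfP.
    have d2 := @is_derive1_comp R f (fun h => s + h) 0 _ _ ds d1.
    apply: (@trigger_derive R G1 0 _ _ (is_deriveZ (f s * f 0) d2)).
    by rewrite /GRing.scale/= mulr1.
  have dG2 : is_derive (0 : R) (1 : R) G2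
      ('D_1 f 0 * f 0 * f s + f 0 * (2 * s * f s)).
    have d1 : is_derive (0 : R) (1 : R) (fun h : R => s * h + f s) s.
      by apply: is_derive_eq; rewrite /GRing.scale/=; ring.
    have k00 : k 0 = 0 by rewrite /k mulr0 mul0r.
    have d0 : is_derive (k 0) (1 : R) f ('D_1 f 0) by rewrite k00.
    have d2 := @is_derive1_comp R f k 0 _ _ d0 dk.
    have d3 := is_deriveM d2 (is_deriveM d1 d1).
    apply: (@trigger_derive R G2 0 _ _ d3).
    rewrite /GRing.scale/= k00.
    rewrite [X in _ + X * _](_ : _ = (s * 0 + f s) * (s * 0 + f s))//.
    by field; rewrite gt_eqF.
  have [_ e1] := near_eq_is_derive G12 dG1.
  have [_ e2] := dG2.
  have : f s * f 0 * 'D_1 f s =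
    f s * f 0 * ('D_1 f 0 + 2 * s) by rewrite -e1 e2; ring.
  by apply: mulfI; rewrite mulf_neq0// gt_eqF.
pose g t := f t - (t ^+ 2 + t * 'D_1 f 0).
have dg t : is_derive t (1 : R) g 0.
  have d1 : is_derive t (1 : R) (fun t : R => t ^+ 2) (2 * t).
    by apply: is_derive_eq; rewrite /GRing.scale/=; ring.
  have d2 : is_derive t (1 : R) (fun t : R => t * 'D_1 f 0) ('D_1 f 0).
    by apply: is_derive_eq; rewrite /GRing.scale/=; ring.
  by apply: (@trigger_derive R g t _ _ (is_deriveB (dfP t) (is_deriveD d1 d2)));
    rewrite key; ring.
have gE t : f t = t ^+ 2 + t * 'D_1 f 0 + f 0.
  have := is_derive_0_is_cst t 0 dg.
  rewrite /g expr0n mul0r addr0 subr0 => /eqP.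
  by rewrite subr_eq => /eqP ->; ring.
move=> t; rewrite gE; congr (_ + _ * _ + _).
by rewrite (gE 1) expr1n; ring.
Unshelve. all: by end_near.
Qed.

Section rigidity.
Context {R : realType} {n : nat}.
Local Notation e := (fun i : 'I_n => delta_mx ord0 i : 'rV[R]_n).

Lemma dotv_delta (x : 'rV[R]_n) i : dotv x (e i) = x ord0 i.
Proof.
rewrite /dotv (bigD1 i)//= !mxE !eqxx mulr1 big1 ?addr0// => j ji.
by rewrite !mxE (negbTE ji) andbF mulr0.
Qed.

Lemma coord_shift_invariant (g : 'rV[R]_n -> R) :
  (forall x i t, g (x + t *: e i) = g x) -> forall x, g x = g 0.
Proof.
move=> gi x; rewrite (row_sum_delta x).
elim: (index_enum _) => [|i s IH]; first by rewrite big_nil.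
by rewrite big_cons addrC gi.
Qed.

(** On each axis-parallel line [w] is a monic quadratic, with linear coefficient [b i x].
    Derivatives being given along the axes only, the mixed terms are excluded algebraically. *)
Theorem inversive_rigidity (w : 'rV[R]_n -> R) :
  (forall x, 0 < w x) ->
  (forall x i t, derivable (fun s : R => w (x + s *: e i)) t (1 : R)) ->
  (forall x y, y != 0 -> dotv y y < 1 ->
    w (x + Num.sqrt (w x) *: y) =
    dotv y y * w (x + Num.sqrt (w x) *: sinv y)) ->
  exists (xi : 'rV[R]_n) (d : R), 0 < d /\
    forall x, w x = dotv (x - xi) (x - xi) + d ^+ 2.
Proof.
move=> w0 dw fe.
have sq0 x : 0 < Num.sqrt (w x) by rewrite sqrtr_gt0.
have sqE x : Num.sqrt (w x) ^+ 2 = w x by rewrite sqr_sqrtr// ltW.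
have fe_dir x (v : 'rV[R]_n) (h : R) : v != 0 -> h != 0 ->
    h ^+ 2 * dotv v v < w x ->
    w (x + h *: v) =
    h ^+ 2 * dotv v v / w x * w (x + (w x / (h * dotv v v)) *: v).
  move=> v0 h0 hw; have vv := dotvv_gt0 v0.
  have := fe x ((h / Num.sqrt (w x)) *: v).
  rewrite scaler_eq0 mulf_eq0 invr_eq0 (negbTE h0) (negbTE v0).
  rewrite (gt_eqF (sq0 x)) /=.
  have dE : dotv ((h / Num.sqrt (w x)) *: v) ((h / Num.sqrt (w x)) *: v) =
      h ^+ 2 * dotv v v / w x.
    by rewrite !dotvE -[in RHS]sqE; field; rewrite gt_eqF.
  rewrite dE ltr_pdivrMr// mul1r sinvZ /sinv !scalerA.
  have -> : Num.sqrt (w x) * (h / Num.sqrt (w x)) = h.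
    by field; rewrite gt_eqF.
  move=> /(_ isT hw) ->; congr (_ * w (_ + _ *: _)).
  by rewrite -[in RHS]sqE; field; rewrite h0 !gt_eqF.
have ee i : dotv (e i) (e i) = 1 by rewrite dotv_delta !mxE !eqxx.
have e0 i : e i != 0 by rewrite -dotvv_eq0 ee oner_eq0.
pose b (i : 'I_n) (x : 'rV[R]_n) : R := w (x + e i) - w x - 1.
have quad x i t : w (x + t *: e i) = t ^+ 2 + t * b i x + w x.
  have := @inversive_monic_quadratic R (fun s => w (x + s *: e i)) _ _ _ t.
  rewrite scale1r scale0r addr0; apply=> //.
  move=> s h h0 hs.
  have := fe_dir (x + s *: e i) (e i) h (e0 i) h0.
  rewrite ee !mulr1 -!addrA -!scalerDl; exact.
(* On the plane spanned by [e i] and [e j], [w] is the sum of the two quadratics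
   plus a term [D s t]; the identity along the diagonal forces [D = 0]. *)
have mixed x i j : i != j -> b i (x + e j) = b i x.
  move=> ij; pose v := e i + e j.
  have eij : dotv (e i) (e j) = 0.
    by rewrite dotv_delta mxE eqxx /= eq_sym (negbTE ij).
  have vv : dotv v v = 2.
    by rewrite /v !dotvE !ee (dotvC (e j)) eij; ring.
  have v0 : v != 0 by rewrite -dotvv_eq0 vv pnatr_eq0.
  (* A mixed second difference of [w]: computed along [e j], its quadratic terms in [s] cancel. *)
  have bD s : b i (x + s *: e j) - b i x = s * (b j (x + e i) - b j x).
    rewrite {1 2}/b.
    have -> : x + s *: e j + e i = x + e i + s *: e j by rewrite addrAC.
    by rewrite !quad; ring.
  pose D := b i (x + e j) - b i x.
  have DE : b j (x + e i) - b j x = D by rewrite -[LHS]mul1r -bD scale1r.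
  have wv T : w (x + T *: v) =
      2 * T ^+ 2 + T * (b i x + b j x) + w x + T ^+ 2 * D.
    rewrite /v scalerDr addrA addrAC quad quad.
    have := bD T; rewrite DE => /eqP; rewrite subr_eq => /eqP ->; ring.
  (* With [w x = 4 h^2] the inversion about [x] takes [x + h v] to [x + 2 h v], with factor [1/2].
     All terms then agree except those in [D], which are [h^2 D] and [2 h^2 D]. *)
  pose h := Num.sqrt (w x) / 2.
  have h0 : 0 < h by rewrite divr_gt0.
  have hE : w x = 4 * h ^+ 2 by rewrite /h -[LHS]sqE; field.
  have hlt : h ^+ 2 * dotv v v < w x.
    by rewrite vv hE; have := exprn_gt0 2 h0; lra.
  have := fe_dir x v h v0 (lt0r_neq0 h0) hlt.
  rewrite !wv vv hE.
  have -> : 4 * h ^+ 2 / (h * 2) = 2 * h by field; rewrite gt_eqF.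
  have -> : h ^+ 2 * 2 / (4 * h ^+ 2) = 2^-1 by field; rewrite gt_eqF.
  move=> E; have : h ^+ 2 * D = 0 by lra.
  by move=> /eqP; rewrite mulf_eq0 expf_eq0 (gt_eqF h0) /= => /eqP /subr0_eq.
have bshift i : forall x,
    b i x - 2 * x ord0 i = b i 0 - 2 * (0 : 'rV[R]_n) ord0 i.
  apply: coord_shift_invariant => x j t.
  have [<-|ij] := eqVneq i j.
    have E : b i (x + t *: e i) = b i x + 2 * t.
      have -> : b i (x + t *: e i) =
          w (x + (t + 1) *: e i) - w (x + t *: e i) - 1.
        by rewrite /b scalerDl scale1r addrA.
      by rewrite !quad; ring.
    by rewrite E !mxE !eqxx /=; ring.
  have E : b i (x + t *: e j) = b i x.
    have bD : b i (x + t *: e j) - b i x = t * (b j (x + e i) - b j x).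
      rewrite {1 2}/b.
      have -> : x + t *: e j + e i = x + e i + t *: e j by rewrite addrAC.
      by rewrite !quad; ring.
    apply/eqP; rewrite -subr_eq0 bD mixed ?subrr ?mulr0//.
    by rewrite eq_sym.
  by rewrite E !mxE eqxx (negbTE ij) mulr0 addr0.
have bE i x : b i x = 2 * x ord0 i + b i 0.
  have := bshift i x; rewrite mxE mulr0 subr0 => /eqP.
  by rewrite subr_eq => /eqP ->; ring.
pose beta : 'rV[R]_n := \row_i b i 0.
have wE x : w x = dotv x x + dotv x beta + w 0.
  have := @coord_shift_invariant (fun x => w x - (dotv x x + dotv x beta)).
  move=> /= inv; have /inv/(_ x) : forall y i t,
      w (y + t *: e i) - (dotv (y + t *: e i) (y + t *: e i) +
        dotv (y + t *: e i) beta) = w y - (dotv y y + dotv y beta).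
    move=> y i t.
    rewrite quad bE !dotvE (dotvC (e i) y) (dotvC (e i) beta) !dotv_delta.
    rewrite !mxE !eqxx mulr1.
    ring.
  by rewrite !dot0v => h; lra.
(* Completing the square; the remaining constant is [w xi], positive by hypothesis, which provides
   [d]. *)
pose xi := (- 2^-1) *: beta.
exists xi, (Num.sqrt (w xi)); split => // x.
by rewrite sqE (wE x) (wE xi) /xi !dotvE (dotvC beta x); field.
Qed.

End rigidity.

(** * The integral system *)

Section integral_system.
Context {R : realType} {n : nat} (p q : R).
Hypotheses (n0 : (0 < n)%N) (p0 : 0 < p) (q0 : 0 < q).
Hypothesis pq : p * q = p + n%:R * 2.

Lemma kerK0 (z : 'rV[R]_n) : kerK p 0 z = 1.
Proof. by rewrite /kerK /invdistsq !dot0v mulr0 subr0 mul0r addr0 powR1. Qed.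

(** At the origin the kernel is 1 and only the integral of [v^(- q)] remains; its translation
    invariance makes the constants of [riesz_rigidity] common to all centers. *)
Lemma ktrans_shift (v : 'rV[R]_n -> R) (b : 'rV[R]_n) :
  measurable_fun setT v -> ktrans p q (fun z => v (z + b)) 0 = ktrans p q v 0.
Proof.
move=> mv; rewrite /ktrans; congr fine.
transitivity (\int[lebesgue_rV R n]_z (v (z + b) `^ (- q))%:E)%E.
  by apply: eq_integral => z _; rewrite kerK0 mul1r.
rewrite (@ge0_integral_rV_shift R n (fun z => (v z `^ (- q))%:E) b).
- by apply: eq_integral => z _; rewrite kerK0 mul1r.
- apply/measurable_EFinP; exact: (measurableT_comp (measurable_powR _) mv).
- by move=> z; rewrite lee_fin powR_ge0.
Qed.

Lemma slack_eq0_center (u v : 'rV[R]_n -> R) (l : R) :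
  slack p q u v l 0 = 0 -> u 0 = l `^ p * ktrans p q v 0.
Proof. by move=> /subr0_eq; rewrite !scaler0. Qed.

Lemma slack_eq0_kelvin (u v : 'rV[R]_n -> R) (l : R) y : 0 < l -> y != 0 ->
  measurable_fun setT v -> riesz p q u v ->
  slack p q u v l y = 0 ->
  u (l *: y) = dotv y y `^ (p / 2) * u (l *: sinv y).
Proof.
move=> l0 y0 mv uv /subr0_eq ->.
have ly : l^-1 *: y != 0 by rewrite scaler_eq0 invr_eq0 (gt_eqF l0).
rewrite (ktrans_kelvin n0 p0 mv uv ly) sinvZ invrK mulrA; congr (_ * _).
have li : 0 <= l^-1 by rewrite invr_ge0 ltW.
rewrite !dotvE.
rewrite !powRM ?mulr_ge0 ?dotvv_ge0//.
rewrite !mulrA -[RHS]mul1r; congr (_ * _).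
rewrite -mulrA -powRM// -expr2 sqr_powR_half// -powRM ?(ltW l0)//.
by rewrite divff ?gt_eqF// powR1.
Qed.

Theorem riesz_rigidity (u v : 'rV[R]_n -> R) :
  (forall x, 0 < u x) -> (forall x, 0 < v x) ->
  continuous u -> continuous v ->
  (forall (i : 'I_n) x, derivable u x (delta_mx ord0 i)) ->
  riesz p q u v -> riesz p q v u ->
  exists (a b d : R) (xi : 'rV[R]_n),
    [/\ 0 < a, 0 < b, 0 < d,
        forall x, u x = a * (dotv (x - xi) (x - xi) + d ^+ 2) `^ (p / 2) &
        forall x, v x = b * (dotv (x - xi) (x - xi) + d ^+ 2) `^ (p / 2)].
Proof.
move=> u0 v0 cu cv du uv vu.
have mu := continuous_measurable_rV cu.
have mv := continuous_measurable_rV cv.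
pose a := ktrans p q v 0; pose b := ktrans p q u 0.
have a0 : 0 < a by exact: (ktrans_gt0 n0 p0 u0 mv uv).
have b0 : 0 < b by exact: (ktrans_gt0 n0 p0 v0 mu vu).
have cshift (f : 'rV[R]_n -> R) (x : 'rV[R]_n) :
    continuous f -> continuous (fun z : 'rV[R]_n => f (z + x)).
  move=> cf z.
  have c : (z' + x) @[z' --> z] --> z + x.
    exact: (@cvgD _ _ _ (nbhs z) _ id (fun=> x) _ _ cvg_id (cvg_cst _)).
  exact: (@continuous_comp _ _ _ (fun z' : 'rV[R]_n => z' + x) f z c (cf _)).
have crit x : exists2 l, 0 < l & [/\ u x = l `^ p * a, v x = l `^ p * b &
    forall y, y != 0 -> dotv y y < 1 ->
      u (x + l *: y) = dotv y y `^ (p / 2) * u (x + l *: sinv y)].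
  have uvx := riesz_shift x mv uv.
  have vux := riesz_shift x mu vu.
  have mvx := continuous_measurable_rV (cshift v x cv).
  have [l l0 lP] := critical_dilation n0 p0 q0 pq (fun z => u0 (z + x))
    (fun z => v0 (z + x)) (cshift u x cu) (cshift v x cv) uvx vux.
  have [|lu lv] := lP 0; first by rewrite /oball/= dot0v.
  exists l; first exact: l0.
  split.
  - by have := slack_eq0_center lu; rewrite add0r ktrans_shift.
  - by have := slack_eq0_center lv; rewrite add0r ktrans_shift.
  - move=> y y0 y1; have [ly _] := lP y y1.
    have := slack_eq0_kelvin l0 y0 mvx uvx ly.
    by rewrite ![x + _]addrC.
(* The radii are known only to exist, so [w] is defined from [u], whose derivatives it inherits;
   [wE] identifies it with the squared radius. *)
clearbody a b; pose w x := (u x / a) `^ (2 / p).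
have wE x l : 0 < l -> u x = l `^ p * a -> w x = l ^+ 2.
  move=> l0 ux; rewrite /w ux mulfK ?gt_eqF// -[LHS]powRrM.
  by rewrite mulrCA divff ?gt_eqF// mulr1 powR_mulrn// ltW.
have w0 x : 0 < w x by rewrite powR_gt0// divr_gt0.
have [xi [d [d0 wq]]] : exists (xi : 'rV[R]_n) (d : R), 0 < d /\
    forall x, w x = dotv (x - xi) (x - xi) + d ^+ 2.
  apply: inversive_rigidity => //.
  - move=> x i t.
    have dg : derivable (fun s : R => u (x + s *: delta_mx ord0 i)) t (1 : R).
      have := du i (x + t *: delta_mx ord0 i); rewrite /derivable.
      set f := (X in cvg (X @ _)) => cf.
      set g := (X in cvg (X @ _)); suff -> : g = f by [].
      apply/funext => h; rewrite /f /g /=; congr (_ *: (u _ - _)).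
      by rewrite [h *: (1 : R)]mulr1 scalerDl addrCA.
    have ut : 0 < u (x + t *: delta_mx ord0 i) / a by rewrite divr_gt0.
    have d1 : is_derive t (1 : R) (fun s : R => u (x + s *: delta_mx ord0 i))
      ('D_1 (fun s : R => u (x + s *: delta_mx ord0 i)) t) := derivableP dg.
    have d2 (y : R) : is_derive y (1 : R) (fun s : R => s / a) a^-1.
      by apply: is_derive_eq; rewrite /GRing.scale/=; ring.
    pose us (s : R) : R := u (x + s *: delta_mx ord0 i).
    have d3 := @is_derive1_comp R (fun s => s / a) us t _ _ (d2 (us t)) d1.
    have d4 := @is_derive1_comp R (@powR R ^~ (2 / p)) (fun s => us s / a) t _ _
      (is_derive1_powR (2 / p) ut) d3.
    exact: (@ex_derive _ _ _ _ _ _ _ d4).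
  - move=> x y y0 y1; have [l l0 [ux _ fe]] := crit x.
    rewrite (wE x l l0 ux) sqrtr_sqr gtr0_norm// /w fe//.
    rewrite -mulrA powRM ?powR_ge0 ?divr_ge0 ?ltW// -powRrM.
    have -> : p / 2 * (2 / p) = 1 by field; rewrite gt_eqF.
    by rewrite powRr1// dotvv_ge0.
exists a, b, d, xi; split => // x; rewrite -wq; have [l l0 [ux vx _]] := crit x.
- by rewrite (wE x l l0 ux) sqr_powR_half ?(ltW l0)// mulrC.
- by rewrite (wE x l l0 ux) sqr_powR_half ?(ltW l0)// mulrC.
Qed.

End integral_system.

(** * The system in terms of [alpha], [theta] and [kappa] *)

Theorem theorem3p6 (R : realType) (n : nat) (alpha theta kappa : R)
    (u v : 'rV[R]_n -> R)
    (n_ge1 : (1 <= n)%N) (alpha_gt_n : n%:R < alpha)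
    (thetaE : theta = (n%:R + alpha) / (n%:R - alpha))
    (kappaE : kappa = (n%:R + alpha) / (n%:R - alpha))
    (u_gt0 : forall x, 0 < u x) (v_gt0 : forall x, 0 < v x)
    (u_smooth : smooth u) (v_smooth : smooth v)
    (uE : forall y, (u y)%:E =
      (\int[lebesgue_rV R n]_x
         (enorm (x - y) `^ (alpha - n%:R) * v x `^ kappa)%:E)%E)
    (vE : forall x, (v x)%:E =
      (\int[lebesgue_rV R n]_y
         (enorm (x - y) `^ (alpha - n%:R) * u y `^ theta)%:E)%E) :
  exists (c1 c2 d : R) (xi0 : 'rV[R]_n),
    [/\ 0 < c1, 0 < c2, 0 < d,
        forall xi, u xi =
          c1 * (1 / (enorm (xi - xi0) ^+ 2 + d ^+ 2)) `^ ((n%:R - alpha) / 2) &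
        forall xi, v xi =
          c2 * (1 / (enorm (xi - xi0) ^+ 2 + d ^+ 2)) `^ ((n%:R - alpha) / 2)].
Proof.
pose p := alpha - n%:R; pose q := (n%:R + alpha) / p.
have p0 : 0 < p by rewrite subr_gt0.
have q0 : 0 < q by rewrite divr_gt0// ltr_wpDl// (le_lt_trans _ alpha_gt_n).
have qN : (n%:R + alpha) / (n%:R - alpha) = - q.
  by rewrite /q /p -opprB invrN mulrN.
have pq : p * q = p + n%:R * 2.
  by rewrite /q mulrC divfK ?gt_eqF// /p; ring.
have kerE (y x : 'rV[R]_n) : enorm (x - y) `^ (alpha - n%:R) = kerA p y x.
  by rewrite enorm_powR /kerA distsqE.
have uv : riesz p q u v.
  by move=> y; rewrite uE; apply: eq_integral => x _; rewrite kerE kappaE qN.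
have vu : riesz p q v u.
  move=> x; rewrite vE; apply: eq_integral => y _.
  by rewrite -enormN opprB kerE thetaE qN.
have [cu du] := u_smooth [::]; have [cv _] := v_smooth [::].
have [a [b [d [xi [a0 b0 d0 ua vb]]]]] :=
  riesz_rigidity n_ge1 p0 q0 pq u_gt0 v_gt0 cu cv du uv vu.
(* The exponent is [- p / 2], so the power of the inverse is a positive power of the quadratic. *)
have powE x : (1 / (enorm (x - xi) ^+ 2 + d ^+ 2)) `^ ((n%:R - alpha) / 2) =
    (dotv (x - xi) (x - xi) + d ^+ 2) `^ (p / 2).
  rewrite enorm_sqr div1r powR_invl ?addr_ge0 ?dotvv_ge0 ?sqr_ge0//.
  by rewrite -powRN /p; congr (_ `^ _); field.
by exists a, b, d, xi; split => // x; rewrite powE ?ua ?vb.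
Qed.
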